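(* Let $\mathcal{A}$ be a smooth proper triangulated category which is Calabi-Yau of dimension $3$. Let $\mathrm{rank}_1, \mathrm{rank}_2$ be non-trivial numerical rank functions on $\mathcal{A}$ and, for $i=1,2$, let $\mathfrak{T}_{\mathcal{A},i}^{\bullet}$ be a homological unit for $\mathcal{A}$ with respect to $\mathrm{rank}_i$. Let $\mathrm{cl} : \mathcal{A} \to \mathrm{K}_{num}(\mathcal{A})$ be the class map, and let $\mathcal{A}_{unitary}^{(i)}$ be the set of objects $\mathcal{F} \in \mathcal{A}$ such that $\mathrm{Hom}^{\bullet}_{\mathcal{A}}(\mathcal{F},\mathcal{F}) \simeq \mathfrak{T}_{\mathcal{A},i}^{\bullet}$ as graded rings. For $p,q \in \{0,\ldots,3\}$ let $h^{p,q}_i(\mathcal{A})$ be the Hodge numbers of $\mathcal{A}$ associated to $\mathfrak{T}_{\mathcal{A},i}^{\bullet}$. Then: 1. If both $\mathrm{cl}(\mathcal{A}_{unitary}^{(1)})$ and $\mathrm{cl}(\mathcal{A}_{unitary}^{(2)})$ generate $\mathrm{K}_{num}(\mathcal{A}) \otimes \mathbb{C}$, then $h^{p,q}_1(\mathcal{A}) = h^{p,q}_2(\mathcal{A})$ for all $p,q \in \{0,\ldots,3\}$. 2. If $\mathfrak{T}_{\mathcal{A},1}^{\bullet} = \mathbb{C} \oplus \mathbb{C}[3]$, $\mathrm{cl}(\mathcal{A}_{unitary}^{(1)})$ generates $\mathrm{K}_{num}(\mathcal{A}) \otimes \mathbb{C}$, and there exists a unitary object in $\mathcal{A}$ with respect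 to $\mathfrak{T}_{\mathcal{A},2}^{\bullet}$, then $h^{p,q}_1(\mathcal{A}) = h^{p,q}_2(\mathcal{A})$ for all $p,q \in \{0,\ldots,3\}$.
   Context: Conventions: all triangulated categories are $\mathbb{C}$-linear and proper, i.e. realizable as derived categories of DG-modules over a proper DG-algebra; ''smooth'' means realizable as a derived category of DG-modules over a smooth DG-algebra. $\mathcal{A}$ is Calabi-Yau of dimension $p$ if the shift $[p]$ is a Serre functor for $\mathcal{A}$. Write $\mathrm{Hom}^{\bullet}_{\mathcal{A}}(\mathcal{E},\mathcal{F}) = \bigoplus_k \mathrm{Hom}_{\mathcal{A}}(\mathcal{E},\mathcal{F}[k])$. Rank function: a function $\mathrm{rk}:\mathcal{A}\to\mathbb{Z}$ additive with respect to exact triangles and with $\mathrm{rk}(\mathcal{F}[1])=-\mathrm{rk}(\mathcal{F})$ for all $\mathcal{F}$. It is trivial if it is the zero function. It is numerical if it descends to a map $\mathrm{K}_{num}(\mathcal{A})\to\mathbb{Z}$, where $\mathrm{K}_{num}(\mathcal{A})$ is the quotient of $\mathrm{K}_0(\mathcal{A})$ by the kernel of the bilinear form $\chi(\mathcal{E},\mathcal{F})=\sum_{k \in \mathbb{Z}}(-1)^k\dim \mathrm{Ext}^k(\mathcal{E},\mathcal{F})$. Homological unit: let $\mathcal{A}$ carry a non-trivial rank function $\mathrm{rank}$. A graded algebra $\mathfrak{T}_{\mathcal{A}}^{\bullet}$ is a homological unit for $\mathcal{A}$ (with respect to $\mathrm{rank}$) if it is maximal (with respect to embeddings of graded algebras)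 for the following property: for every object $\mathcal{F}\in\mathcal{A}$ there is a pair of morphisms $i_{\mathcal{F}}:\mathfrak{T}_{\mathcal{A}}^{\bullet}\to\mathrm{Hom}^{\bullet}_{\mathcal{A}}(\mathcal{F},\mathcal{F})$ and $t_{\mathcal{F}}:\mathrm{Hom}^{\bullet}_{\mathcal{A}}(\mathcal{F},\mathcal{F})\to\mathfrak{T}_{\mathcal{A}}^{\bullet}$ such that (i) $i_{\mathcal{F}}$ is a graded algebra morphism, functorial in the sense that for all $\mathcal{F},\mathcal{G}\in\mathcal{A}$, $a\in\mathfrak{T}_{\mathcal{A}}^{k}$ and $\psi:\mathcal{F}\to\mathcal{G}$ one has $\psi[k]\circ i_{\mathcal{F}}(a)=i_{\mathcal{G}}(a)\circ\psi$; (ii) $t_{\mathcal{F}}$ is a morphism of graded vector spaces with $t_{\mathcal{F}}(i_{\mathcal{F}}(a))=\mathrm{rank}(\mathcal{F})\,a$ for all $a\in\mathfrak{T}_{\mathcal{A}}^{\bullet}$. An object $\mathcal{F}$ is unitary with respect to $\mathfrak{T}_{\mathcal{A}}^{\bullet}$ if $\mathrm{Hom}^{\bullet}_{\mathcal{A}}(\mathcal{F},\mathcal{F})\simeq\mathfrak{T}_{\mathcal{A}}^{\bullet}$ as graded rings. $\mathbb{C}\oplus\mathbb{C}[3]$ denotes the graded algebra with one copy of $\mathbb{C}$ in degree $0$ (spanned by the unit) and one in degree $3$, and zero elsewhere. Hodge numbers: for $\mathcal{A}$ smooth proper Calabi-Yau of dimension $3$ with a homological unit $\mathfrak{T}_{\mathcal{A}}^{\bullet}$,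 let $\mathrm{HH}_{\bullet}(\mathcal{A})$ be its Hochschild homology, graded so that $\mathrm{HH}^{\bullet}(\mathcal{A})\simeq\mathrm{HH}_{\bullet-3}(\mathcal{A})$, where $\mathrm{HH}^{\bullet}$ is Hochschild cohomology. Define: - $h^{i,0}(\mathcal{A})=\dim\mathfrak{T}_{\mathcal{A}}^{3-i}$ for $i=0,\ldots,3$; - $h^{3,1}(\mathcal{A})=\dim\mathrm{HH}_{-2}(\mathcal{A})-h^{2,0}(\mathcal{A})$; - $h^{3,2}(\mathcal{A})=h^{1,0}(\mathcal{A})$ and $h^{2,1}(\mathcal{A})=\dim\mathrm{HH}_{-1}(\mathcal{A})-h^{1,0}(\mathcal{A})-h^{3,2}(\mathcal{A})$; - $h^{3,3}(\mathcal{A})=h^{0,0}(\mathcal{A})$ and $h^{1,1}(\mathcal{A})=h^{2,2}(\mathcal{A})=\frac{1}{2}\left(\dim\mathrm{HH}_0(\mathcal{A})-h^{0,0}(\mathcal{A})-h^{3,3}(\mathcal{A})\right)$; - $h^{p,q}(\mathcal{A})=h^{q,p}(\mathcal{A})$ for all $p,q\in\{0,\ldots,3\}$. *)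

(* Defs.v *)
From HB Require Import structures.
From mathcomp Require Import all_boot all_order all_algebra.
From mathcomp Require Import boolp classical_sets cardinality fsbigop reals.
From mathcomp Require Import complex freeg.

Set Implicit Arguments.
Unset Strict Implicit.
Unset Printing Implicit Defensive.

Import Order.TTheory GRing.Theory Num.Theory.
Local Open Scope classical_set_scope.
Local Open Scope ring_scope.
Local Open Scope quotient_scope.

(** * Linear algebra *)

Section Span.
Variables (R : nzRingType) (V : lmodType R).

Inductive lspan (S : set V) : V -> Prop :=
| lspan0 : lspan S 0
| lspanD a u v : S u -> lspan S v -> lspan S (a *: u + v).

Lemma lspan_add (S : set V) u v : lspan S u -> lspan S v -> lspan S (u + v).
Proof.
move=> Su Sv; elim: Su => [|a x y Sx _ IH]; first by rewrite add0r.
by rewrite -addrA; apply: lspanD.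
Qed.

Lemma lspan_scale (S : set V) a u : lspan S u -> lspan S (a *: u).
Proof.
elim=> [|b x y Sx _ IH]; first by rewrite scaler0; exact: lspan0.
by rewrite scalerDr scalerA; apply: lspanD.
Qed.

Lemma lspan_opp (S : set V) u : lspan S u -> lspan S (- u).
Proof. by move=> /(lspan_scale (-1)); rewrite scaleN1r. Qed.

Definition lspan_pred (S : set V) : {pred V} := fun x => `[< lspan S x >].

Lemma lspan_predP (S : set V) x : reflect (lspan S x) (x \in lspan_pred S).
Proof. exact: asboolP. Qed.

Lemma lspan_pred_zmod (S : set V) : zmod_closed (lspan_pred S).
Proof.
split=> [|x y /lspan_predP xS /lspan_predP yS]; apply/lspan_predP.
  exact: lspan0.
by apply: lspan_add => //; apply: lspan_opp.
Qed.

HB.instance Definition _ (S : set V) :=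
  GRing.isZmodClosed.Build V (lspan_pred S) (lspan_pred_zmod S).

(* The quotient of V by the submodule spanned by S. *)
Definition lquot (S : set V) := Quotient.quot (lspan_pred S).

HB.instance Definition _ (S : set V) := GRing.Zmodule.on (lquot S).
HB.instance Definition _ (S : set V) := Quotient.on (lquot S).

Definition lquot_pi (S : set V) (x : V) : lquot S := \pi_(lquot S) x.

Definition lquot_scale (S : set V) (a : R) (x : lquot S) : lquot S :=
  lquot_pi S (a *: repr x).

Lemma lquot_piP (S : set V) x y : lquot_pi S x = lquot_pi S y <-> lspan S (x - y).
Proof.
rewrite /lquot_pi; split=> [/eqP|H].
  by rewrite -[_ == _]/(x == y %[mod lquot S]) -Quotient.idealrBE => /lspan_predP.
apply/eqP; rewrite -[_ == _]/(x == y %[mod lquot S]) -Quotient.idealrBE.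
exact/lspan_predP.
Qed.

Lemma lquot_piD (S : set V) : {morph lquot_pi S : x y / x + y}.
Proof. by move=> x y; rewrite /lquot_pi /= raddfD. Qed.

Lemma lquot_repr (S : set V) (x : lquot S) : lquot_pi S (repr x) = x.
Proof. exact: reprK. Qed.

Lemma lquot_piZ (S : set V) a x : lquot_pi S (a *: x) = lquot_scale a (lquot_pi S x).
Proof.
apply/lquot_piP; rewrite -scalerBr; apply: lspan_scale.
by apply/lquot_piP; rewrite lquot_repr.
Qed.

Lemma lquot_scaleA (S : set V) a b (x : lquot S) :
  lquot_scale a (lquot_scale b x) = lquot_scale (a * b) x.
Proof. by rewrite -[x]lquot_repr -!lquot_piZ scalerA. Qed.

Lemma lquot_scale1 (S : set V) : left_id 1 (@lquot_scale S).
Proof. by move=> x; rewrite -[x]lquot_repr -lquot_piZ scale1r. Qed.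

Lemma lquot_scaleDr (S : set V) : right_distributive (@lquot_scale S) +%R.
Proof.
move=> a x y; rewrite -[x]lquot_repr -[y]lquot_repr -lquot_piD -!lquot_piZ.
by rewrite scalerDr lquot_piD.
Qed.

Lemma lquot_scaleDl (S : set V) (x : lquot S) :
  {morph (@lquot_scale S)^~ x : a b / a + b}.
Proof. by move=> a b; rewrite -[x]lquot_repr -!lquot_piZ scalerDl lquot_piD. Qed.

HB.instance Definition _ (S : set V) :=
  GRing.Zmodule_isLmodule.Build R (lquot S) (@lquot_scaleA S)
    (@lquot_scale1 S) (@lquot_scaleDr S) (@lquot_scaleDl S).

End Span.

Section Dimension.
Variables (K : fieldType) (V : lmodType K).

(* Z / W has a basis with n elements. *)
Definition has_dim (Z W : set V) (n : nat) : Prop :=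
  exists v : 'I_n -> V, (forall i, Z (v i)) /\
    forall z, Z z -> exists! c : 'rV[K]_n, W (z - \sum_(i < n) c 0 i *: v i).

Definition fin_dim (Z W : set V) : Prop := exists n, has_dim Z W n.

(* By convention 0 if Z / W is infinite-dimensional. *)
Definition qdim (Z W : set V) : nat := xget 0%N [set n | has_dim Z W n].

Definition ldim : nat := qdim setT [set 0].

End Dimension.
Arguments ldim {K} V.

Definition bilin (K : fieldType) (U V W : lmodType K) (f : U -> V -> W) : Prop :=
  (forall a u u' v, f (a *: u + u') v = a *: f u v + f u' v) /\
  (forall a u v v', f u (a *: v + v') = a *: f u v + f u v').

Lemma bilin0l (K : fieldType) (U V W : lmodType K) (f : U -> V -> W) v :
  bilin f -> f 0 v = 0.
Proof. by case=> /(_ (-1) 0 0 v); rewrite scaleN1r oppr0 addr0 scaleN1r addNr. Qed.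

Lemma bilin0r (K : fieldType) (U V W : lmodType K) (f : U -> V -> W) u :
  bilin f -> f u 0 = 0.
Proof. by case=> _ /(_ (-1) u 0 0); rewrite scaleN1r oppr0 addr0 scaleN1r addNr. Qed.

Lemma bilinZl (K : fieldType) (U V W : lmodType K) (f : U -> V -> W) a u v :
  bilin f -> f (a *: u) v = a *: f u v.
Proof.
by move=> bf; have [/(_ a u 0 v)] := bf; rewrite !addr0 (bilin0l v bf) addr0.
Qed.

Lemma bilinZr (K : fieldType) (U V W : lmodType K) (f : U -> V -> W) a u v :
  bilin f -> f u (a *: v) = a *: f u v.
Proof.
by move=> bf; have [_ /(_ a u v 0)] := bf; rewrite !addr0 (bilin0r u bf) addr0.
Qed.

Lemma bilinDl (K : fieldType) (U V W : lmodType K) (f : U -> V -> W) u u' v :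
  bilin f -> f (u + u') v = f u v + f u' v.
Proof. by case=> /(_ 1 u u' v); rewrite !scale1r. Qed.

Lemma bilinDr (K : fieldType) (U V W : lmodType K) (f : U -> V -> W) u v v' :
  bilin f -> f u (v + v') = f u v + f u v'.
Proof. by case=> _ /(_ 1 u v v'); rewrite !scale1r. Qed.

Section Lin.
Variables (K : fieldType) (U V : lmodType K) (f : U -> V).
Hypothesis f_lin : forall a x y, f (a *: x + y) = a *: f x + f y.

Lemma lin0 : f 0 = 0.
Proof. by have := f_lin (-1) 0 0; rewrite scaleN1r oppr0 addr0 scaleN1r addNr. Qed.

Lemma linZ a x : f (a *: x) = a *: f x.
Proof. by have := f_lin a x 0; rewrite !addr0 lin0 addr0. Qed.

Lemma linD x y : f (x + y) = f x + f y.
Proof. by have := f_lin 1 x y; rewrite !scale1r. Qed.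

Lemma linN x : f (- x) = - f x.
Proof. by rewrite -scaleN1r linZ scaleN1r. Qed.
End Lin.

(** * Graded and differential graded algebras and bimodules *)

(* The index [k] of a product is a parameter constrained by [i + j = k], which
   avoids transports along equalities of degrees. *)

Section Graded.
Variable K : fieldType.

Record galg := Galg {
  gcar :> int -> lmodType K;
  gmul : forall i j k : int, i + j = k -> gcar i -> gcar j -> gcar k;
  gone : gcar 0;
  gmul_bilin : forall i j k (h : i + j = k), bilin (gmul h);
  gmulA : forall i j k ij jk n (h1 : i + j = ij) (h2 : ij + k = n)
    (h3 : j + k = jk) (h4 : i + jk = n) a b c,
    gmul h2 (gmul h1 a b) c = gmul h4 a (gmul h3 b c);
  gmul1l : forall i (h : 0 + i = i) a, gmul h gone a = a;
  gmul1r : forall i (h : i + 0 = i) a, gmul h a gone = a }.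

Definition galg_mor (S T : galg) (f : forall k, S k -> T k) : Prop :=
  [/\ forall k a x y, f k (a *: x + y) = a *: f k x + f k y,
      forall i j k (h : i + j = k) x y,
        f k (gmul h x y) = gmul h (f i x) (f j y)
    & f 0 (gone S) = gone T].

(* Only additivity is required, not linearity. *)
Definition gring_iso (S T : galg) : Prop :=
  exists f : forall k, S k -> T k,
    [/\ forall k x y, f k (x + y) = f k x + f k y,
        forall i j k (h : i + j = k) x y,
          f k (gmul h x y) = gmul h (f i x) (f j y),
        f 0 (gone S) = gone T
      & forall k, bijective (f k)].

Definition is_C_plus_C3 (T : galg) : Prop :=
  [/\ forall x : T 0, exists! c : K, x = c *: gone T,
      ldim (T 3) = 1%N
    & forall k, k != 0 -> k != 3 -> forall x : T k, x = 0].

Definition sg (n : int) : K := (-1) ^ n.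

Lemma sgD m n : sg (m + n) = sg m * sg n.
Proof. by rewrite /sg expfzDr // oppr_eq0 oner_eq0. Qed.

Lemma sg0 : sg 0 = 1. Proof. by []. Qed.
Lemma sg1 : sg 1 = -1. Proof. by []. Qed.
Lemma sgS n : sg (n + 1) = - sg n. Proof. by rewrite sgD sg1 mulrN1. Qed.
Lemma sg_sqr n : sg n * sg n = 1.
Proof. by rewrite /sg -expfzMl mulrNN mulr1 exp1rz. Qed.

Record dga := Dga {
  dga_alg :> galg;
  dif : forall i, dga_alg i -> dga_alg (i + 1);
  dif_lin : forall i a (x y : dga_alg i), dif (a *: x + y) = a *: dif x + dif y;
  dif_dif : forall i (x : dga_alg i), dif (dif x) = 0;
  dif_mul : forall i j k (h : i + j = k) (h1 : i + 1 + j = k + 1)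
    (h2 : i + (j + 1) = k + 1) (x : dga_alg i) (y : dga_alg j),
    dif (gmul h x y) = gmul h1 (dif x) y + sg i *: gmul h2 x (dif y) }.

Record dgbimod (A B : dga) := Dgbimod {
  mcar :> int -> lmodType K;
  lact : forall i j k : int, i + j = k -> A i -> mcar j -> mcar k;
  ract : forall i j k : int, i + j = k -> mcar i -> B j -> mcar k;
  mdif : forall i, mcar i -> mcar (i + 1);
  lact_bilin : forall i j k (h : i + j = k), bilin (lact h);
  ract_bilin : forall i j k (h : i + j = k), bilin (ract h);
  lactA : forall i j k ij jk n (h1 : i + j = ij) (h2 : ij + k = n)
    (h3 : j + k = jk) (h4 : i + jk = n) (a b : _) (m : _),
    lact h2 (gmul h1 a b) m = lact h4 a (lact h3 b m);
  ractA : forall i j k ij jk n (h1 : i + j = ij) (h2 : ij + k = n)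
    (h3 : j + k = jk) (h4 : i + jk = n) (m : _) (a b : _),
    ract h2 (ract h1 m a) b = ract h4 m (gmul h3 a b);
  lractA : forall i j k ij jk n (h1 : i + j = ij) (h2 : ij + k = n)
    (h3 : j + k = jk) (h4 : i + jk = n) (a : _) (m : _) (b : _),
    ract h2 (lact h1 a m) b = lact h4 a (ract h3 m b);
  lact1 : forall i (h : 0 + i = i) m, lact h (gone A) m = m;
  ract1 : forall i (h : i + 0 = i) m, ract h m (gone B) = m;
  mdif_lin : forall i a (x y : mcar i), mdif (a *: x + y) = a *: mdif x + mdif y;
  mdif_mdif : forall i (x : mcar i), mdif (mdif x) = 0;
  mdif_lact : forall i j k (h : i + j = k) (h1 : i + 1 + j = k + 1)
    (h2 : i + (j + 1) = k + 1) (a : A i) (m : mcar j),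
    mdif (lact h a m) = lact h1 (dif a) m + sg i *: lact h2 a (mdif m);
  mdif_ract : forall i j k (h : i + j = k) (h1 : i + 1 + j = k + 1)
    (h2 : i + (j + 1) = k + 1) (m : mcar i) (b : B j),
    mdif (ract h m b) = ract h1 (mdif m) b + sg i *: ract h2 m (dif b) }.

(* Closed morphisms of degree 0. *)
Record dgmap (A B : dga) (M N : dgbimod A B) := Dgmap {
  dgfun :> forall i, M i -> N i;
  dgmap_lin : forall i a x y, dgfun (a *: x + y) = a *: @dgfun i x + dgfun y;
  dgmap_lact : forall i j k (h : i + j = k) (a : A i) (m : M j),
    dgfun (lact h a m) = lact h a (dgfun m);
  dgmap_ract : forall i j k (h : i + j = k) (m : M i) (b : B j),
    dgfun (ract h m b) = ract h (dgfun m) b;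
  dgmap_dif : forall i (m : M i), dgfun (mdif m) = mdif (dgfun m) }.

End Graded.

(** ** Constructions *)

Section Ground.
Variable K : fieldType.

(* The ground field in degree 0, as a dg-algebra: the component of degree [k]
   is K^1 if k = 0, and K^0 otherwise. *)
Let car (k : int) : lmodType K := 'rV[K]_(k == 0).
Let tot k (x : car k) : K := \sum_p x 0 p.
Let mul i j k (_ : i + j = k) (x : car i) (y : car j) : car k :=
  const_mx (tot x * tot y).

Let tot_lin k a (x y : car k) : tot (a *: x + y) = a * tot x + tot y.
Proof.
rewrite /tot mulr_sumr -big_split; apply: eq_bigr => p _.
by rewrite !mxE.
Qed.

Let tot_const k c : tot (const_mx c : car k) = (k == 0)%:R * c.
Proof.
rewrite /tot (eq_bigr (fun=> c)); last by move=> p _; rewrite mxE.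
by rewrite sumr_const card_ord mulr_natl.
Qed.

Let tot_nz k (x : car k) : k != 0 -> tot x = 0.
Proof.
move=> /negbTE k0; rewrite /tot; apply: big1 => p _.
by exfalso; have := ltn_ord p; move: (nat_of_ord p) => q; rewrite k0.
Qed.

Let const_tot k (x : car k) : const_mx (tot x) = x.
Proof.
rewrite /tot; apply/rowP => p; rewrite mxE (bigD1 p) //= big1 ?addr0 // => q.
case: p q => p pk [q qk] /eqP []; apply: val_inj => /=.
by move: pk qk; case: (k == 0) => //; case: p; case: q.
Qed.

Let mul_bilin i j k (h : i + j = k) : bilin (mul h).
Proof.
split=> a x y z; rewrite /mul tot_lin; apply/rowP => p; rewrite !mxE.
  by rewrite mulrDl mulrA.
by rewrite mulrDr mulrCA.
Qed.

Let mulA i j k ij jk n (h1 : i + j = ij) (h2 : ij + k = n)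
    (h3 : j + k = jk) (h4 : i + jk = n) (a : car i) (b : car j) (c : car k) :
  mul h2 (mul h1 a b) c = mul h4 a (mul h3 b c).
Proof.
rewrite /mul !tot_const; congr const_mx.
have [i0|/tot_nz ->] := eqVneq i 0; last by rewrite !(mul0r, mulr0).
have [k0|/tot_nz ->] := eqVneq k 0; last by rewrite !(mul0r, mulr0).
have -> : ij = j by rewrite -h1 i0 add0r.
have -> : jk = j by rewrite -h3 k0 addr0.
by rewrite [RHS]mulrCA !mulrA.
Qed.

Let one : car 0 := const_mx 1.

Let mul1l i (h : 0 + i = i) (a : car i) : mul h one a = a.
Proof. by rewrite /mul tot_const eqxx !mul1r const_tot. Qed.

Let mul1r i (h : i + 0 = i) (a : car i) : mul h a one = a.
Proof. by rewrite /mul tot_const eqxx !mulr1 const_tot. Qed.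

Definition ground_alg : galg K := Galg mul_bilin mulA mul1l mul1r.


Definition ground : dga K.
Proof.
refine (@Dga K ground_alg (fun i _ => 0) _ _ _) => //.
- by move=> *; rewrite scaler0 addr0.
- move=> i j k h h1 h2 x y.
  rewrite (bilin0l _ (gmul_bilin ground_alg h1)).
  by rewrite (bilin0r _ (gmul_bilin ground_alg h2)) scaler0 addr0.
Defined.

End Ground.

Lemma shift_idxl (i j k : int) : i + j = k -> i + 1 + j = k + 1.
Proof. by move=> <-; rewrite addrAC. Qed.

Lemma shift_idxr (i j k : int) : i + j = k -> i + (j + 1) = k + 1.
Proof. by move=> <-; rewrite addrA. Qed.

Section Constructions.
Variables (K : fieldType) (A B : dga K).
Implicit Types M N P : dgbimod A B.

Definition dgmap_id M : dgmap M M.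
Proof. by refine (@Dgmap K A B M M (fun i x => x) _ _ _ _). Defined.

Definition dgmap_comp M N P (g : dgmap N P) (f : dgmap M N) : dgmap M P.
Proof.
refine (@Dgmap K A B M P (fun i x => g i (f i x)) _ _ _ _).
- by move=> *; rewrite !dgmap_lin.
- by move=> *; rewrite !dgmap_lact.
- by move=> *; rewrite !dgmap_ract.
- by move=> *; rewrite !dgmap_dif.
Defined.

(* M[1], with the sign rule d(sm) = - s(dm), a (sm) = (-1)^|a| s(am) and
   (sm) b = s(mb). *)
Definition dgshift M : dgbimod A B.
Proof.
refine (@Dgbimod K A B (fun i => M (i + 1))
  (fun i j k h a m => sg K i *: lact (shift_idxr h) a m)
  (fun i j k h m b => ract (shift_idxl h) m b)
  (fun i m => - mdif m) _ _ _ _ _ _ _ _ _ _ _).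
- move=> i j k h; split=> a u v w; have [bl br] := lact_bilin M (shift_idxr h).
    by rewrite bl scalerDr !scalerA mulrC.
  by rewrite br scalerDr !scalerA mulrC.
- by move=> i j k h; have := ract_bilin M (shift_idxl h).
- move=> i j k ij jk n h1 h2 h3 h4 a b m.
  rewrite (lactA h1 (shift_idxr h2) (shift_idxr h3) (shift_idxr h4)).
  by rewrite (bilinZr _ _ _ (lact_bilin M _)) scalerA -h1 sgD.
- by move=> i j k ij jk n h1 h2 h3 h4 m a b; apply: ractA.
- move=> i j k ij jk n h1 h2 h3 h4 a m b.
  rewrite (bilinZl _ _ _ (ract_bilin M _)).
  by rewrite (lractA (shift_idxr h1) (shift_idxl h2) (shift_idxl h3) (shift_idxr h4)).
- by move=> i h m; rewrite sg0 scale1r lact1.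
- by move=> i h m; rewrite ract1.
- by move=> i a x y; rewrite mdif_lin opprD scalerN.
- by move=> i x; rewrite (linN (@mdif_lin _ _ _ _ _)) mdif_mdif !oppr0.
- move=> i j k h h1 h2 a m.
  rewrite (linZ (@mdif_lin _ _ _ _ _)) (mdif_lact _ (shift_idxr h1) (shift_idxr h2)).
  rewrite -[- mdif m]scaleN1r (bilinZr _ _ _ (lact_bilin M _)) scaleN1r sgS.
  by rewrite !scalerDr !scalerN scaleNr opprD.
- move=> i j k h h1 h2 m b.
  rewrite (mdif_ract _ (shift_idxl h1) (shift_idxl h2)).
  rewrite -[- mdif m]scaleN1r (bilinZl _ _ _ (ract_bilin M _)) scaleN1r sgS.
  by rewrite scaleNr opprD opprK.
Defined.

Definition dgshift_map M N (f : dgmap M N) : dgmap (dgshift M) (dgshift N).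
Proof.
refine (@Dgmap K A B (dgshift M) (dgshift N) (fun i x => f (i + 1) x) _ _ _ _).
- by move=> *; rewrite dgmap_lin.
- by move=> *; rewrite (linZ (@dgmap_lin _ _ _ _ _ f _)) dgmap_lact.
- by move=> *; rewrite dgmap_ract.
- by move=> *; rewrite (linN (@dgmap_lin _ _ _ _ _ f _)) dgmap_dif.
Defined.

(* The mapping cone M[1] + N, with differential (x, y) |-> (- dx, f x + dy). *)
Definition dgcone M N (f : dgmap M N) : dgbimod A B.
Proof.
refine (@Dgbimod K A B (fun i => (dgshift M i * N i)%type)
  (fun i j k h a m => (lact h a m.1, lact h a m.2))
  (fun i j k h m b => (ract h m.1 b, ract h m.2 b))
  (fun i m => (mdif m.1, f (i + 1) m.1 + mdif m.2)) _ _ _ _ _ _ _ _ _ _ _).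
- move=> i j k h; have [bl br] := lact_bilin (dgshift M) h.
  have [bl' br'] := lact_bilin N h.
  by split=> a u v w; congr pair; rewrite ?bl ?bl' ?br ?br'.
- move=> i j k h; have [bl br] := ract_bilin (dgshift M) h.
  have [bl' br'] := ract_bilin N h.
  by split=> a u v w; congr pair; rewrite ?bl ?bl' ?br ?br'.
- by move=> i j k ij jk n h1 h2 h3 h4 a b m; congr pair; apply: lactA.
- by move=> i j k ij jk n h1 h2 h3 h4 m a b; congr pair; apply: ractA.
- by move=> i j k ij jk n h1 h2 h3 h4 a m b; congr pair; apply: lractA.
- by move=> i h [x y]; congr pair; apply: lact1.
- by move=> i h [x y]; congr pair; apply: ract1.
- move=> i a [x x'] [y y']; congr pair; first exact: (@mdif_lin _ _ _ (dgshift M)).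
  rewrite /= (@dgmap_lin _ _ _ _ _ f) mdif_lin scalerDr -!addrA; congr (_ + _).
  by rewrite addrCA.
- move=> i [x y]; congr pair; first exact: (@mdif_mdif _ _ _ (dgshift M)).
  rewrite /= (linD (@mdif_lin _ _ _ _ _)) mdif_mdif addr0.
  by rewrite (linN (@dgmap_lin _ _ _ _ _ f _)) dgmap_dif addNr.
- move=> i j k h h1 h2 a [x y]; congr pair.
    exact: (@mdif_lact _ _ _ (dgshift M)).
  rewrite /= (eq_irrelevance h2 (shift_idxr h)).
  rewrite (linZ (@dgmap_lin _ _ _ _ _ f _)) dgmap_lact (mdif_lact h h1 (shift_idxr h)).
  by rewrite (bilinDr _ _ _ (lact_bilin N _)) scalerDr addrCA.
- move=> i j k h h1 h2 [x y] b; congr pair.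
    exact: (@mdif_ract _ _ _ (dgshift M)).
  rewrite /= (eq_irrelevance h1 (shift_idxl h)).
  rewrite dgmap_ract (mdif_ract h (shift_idxl h) h2).
  by rewrite (bilinDl _ _ _ (ract_bilin N _)) addrA.
Defined.

Definition dgcone_in M N (f : dgmap M N) : dgmap N (dgcone f).
Proof.
refine (@Dgmap K A B N (dgcone f) (fun i y => (0, y)) _ _ _ _).
- by move=> *; congr pair; rewrite /= scaler0 addr0.
- by move=> *; congr pair; rewrite (bilin0r _ (lact_bilin (dgshift M) _)).
- by move=> *; congr pair; rewrite (bilin0l _ (ract_bilin (dgshift M) _)).
- move=> i y; congr pair; rewrite /=.
    by rewrite (lin0 (@mdif_lin _ _ _ M _)) oppr0.
  by rewrite (lin0 (@dgmap_lin _ _ _ _ _ f _)) add0r.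
Defined.

Definition dgcone_out M N (f : dgmap M N) : dgmap (dgcone f) (dgshift M).
Proof. by refine (@Dgmap K A B (dgcone f) (dgshift M) (fun i x => x.1) _ _ _ _). Defined.

(* f = dh + hd for a graded A-B-linear map h of degree -1. *)
Definition null_homotopic M N (f : dgmap M N) : Prop :=
  exists h : forall i, M (i + 1) -> N i,
    [/\ forall i a x y, h i (a *: x + y) = a *: h i x + h i y,
        forall i j k (e : i + j = k) (e' : i + (j + 1) = k + 1) (a : A i) m,
          h k (lact e' a m) = sg K i *: lact e a (h j m),
        forall i j k (e : i + j = k) (e' : i + 1 + j = k + 1) m (b : B j),
          h k (ract e' m b) = ract e (h i m) b
      & forall i (m : M (i + 1)),
          f (i + 1) m = mdif (h i m) + h (i + 1) (mdif m)].

Definition homotopic M N (f g : dgmap M N) : Prop :=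
  exists2 k : dgmap M N, null_homotopic k & forall i x, k i x = f i x - g i x.

Definition homotopy_retract M N : Prop :=
  exists (s : dgmap M N) (r : dgmap N M), homotopic (dgmap_comp r s) (dgmap_id M).

(* P is the free bimodule A (x) B on the closed generator e of degree 0:
   closed maps P -> M correspond to degree 0 cocycles of M. *)
Definition free_rank1 P : Prop :=
  exists2 e : P 0, mdif e = 0 &
    forall M (m : M 0), mdif m = 0 ->
      exists f : dgmap P M, f 0 e = m /\
        forall g : dgmap P M, g 0 e = m -> forall i x, g i x = f i x.

(* The thick triangulated subcategory generated by A (x) B; every such object
   is h-projective, so this is a model of the perfect derived category. *)
Inductive perfect : dgbimod A B -> Prop :=
| perfect_free P : free_rank1 P -> perfect P
| perfect_shift M : perfect M -> perfect (dgshift M)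
| perfect_unshift M : perfect (dgshift M) -> perfect M
| perfect_cone M N (f : dgmap M N) : perfect M -> perfect N -> perfect (dgcone f)
| perfect_retract M N : homotopy_retract M N -> perfect N -> perfect M.

End Constructions.

(** ** Cohomology, smoothness, properness, Hochschild homology *)

Section Cohomology.
Variable K : fieldType.

(* Cocycles and coboundaries of degree n + 1. *)
Definition cocycles (M : int -> lmodType K) (d : forall i, M i -> M (i + 1))
  (n : int) : set (M (n + 1)) := [set x | d (n + 1) x = 0].
Definition coboundaries (M : int -> lmodType K) (d : forall i, M i -> M (i + 1))
  (n : int) : set (M (n + 1)) := [set x | exists y, x = d n y].

Arguments cocycles {M} d n.
Arguments coboundaries {M} d n.

Definition proper_dga (B : dga K) : Prop :=
  (forall n, fin_dim (cocycles (@dif K B) n) (coboundaries (@dif K B) n)) /\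
  exists N : nat, forall n : int, (N < `|n|)%N ->
    cocycles (@dif K B) n `<=` coboundaries (@dif K B) n.

Definition acyclic (A B : dga K) (M : dgbimod A B) : Prop :=
  forall n, cocycles (@mdif K A B M) n `<=` coboundaries (@mdif K A B M) n.

Definition quasi_iso (A B : dga K) (M N : dgbimod A B) (f : dgmap M N) : Prop :=
  forall n,
    (forall x, cocycles (@mdif K A B M) n x ->
       coboundaries (@mdif K A B N) n (f _ x) -> coboundaries (@mdif K A B M) n x) /\
    (forall y, cocycles (@mdif K A B N) n y ->
       exists2 x, cocycles (@mdif K A B M) n x &
         coboundaries (@mdif K A B N) n (y - f _ x)).

Definition h_projective (A B : dga K) (P : dgbimod A B) : Prop :=
  forall (N : dgbimod A B) (f : dgmap P N), acyclic N -> null_homotopic f.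

Definition diagonal (B : dga K) : dgbimod B B.
Proof.
refine (@Dgbimod K B B B (@gmul K B) (@gmul K B) (@dif K B) _ _ _ _ _ _ _ _ _ _ _).
- exact: gmul_bilin.
- exact: gmul_bilin.
- exact: gmulA.
- exact: gmulA.
- exact: gmulA.
- exact: gmul1l.
- exact: gmul1r.
- exact: dif_lin.
- exact: dif_dif.
- exact: dif_mul.
- exact: dif_mul.
Defined.

Definition smooth_dga (B : dga K) : Prop :=
  exists P (q : dgmap P (diagonal B)), perfect P /\ quasi_iso q.

(* The degree k part of [B, P], so that P / [B, P] is the tensor product of P
   and B over the enveloping algebra of B. *)
Definition commutators (B : dga K) (P : dgbimod B B) (k : int) : set (P k) :=
  lspan [set x | exists i j (h : i + j = k) (h' : j + i = k) (b : B i) (p : P j),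
    x = lact h b p - sg K (i * j) *: ract h' p b].

Arguments commutators {B} P k.

(* The dimension of H^m(P / [B, P]) for an h-projective bimodule resolution P of
   the diagonal bimodule (this does not depend on P). With this cohomological
   grading, a smooth projective variety has HH_m = sum over q - p = m of
   H^q(Omega^p), and HH^k is HH_(k - n) in the Calabi-Yau case of dimension n. *)
Definition dim_HH (B : dga K) (m : int) : nat :=
  xget 0%N [set d | exists P (q : dgmap P (diagonal B)),
    [/\ h_projective P, quasi_iso q &
      let n := m - 1 in
      has_dim [set x : P (n + 1) | commutators P (n + 1 + 1) (mdif x)]
              [set x : P (n + 1) | exists y : P n, commutators P (n + 1) (x - mdif y)]
              d]].

End Cohomology.

(** * Triangulated categories *)

Record lincat (K : fieldType) := Lincat {
  ob :> Type;
  hom : ob -> ob -> lmodType K;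
  idm : forall X, hom X X;
  compm : forall X Y Z, hom Y Z -> hom X Y -> hom X Z;
  comp_bilin : forall X Y Z, bilin (@compm X Y Z);
  compA : forall X Y Z W (h : hom Z W) (g : hom Y Z) (f : hom X Y),
    compm h (compm g f) = compm (compm h g) f;
  comp1m : forall X Y (f : hom X Y), compm (idm Y) f = f;
  compm1 : forall X Y (f : hom X Y), compm f (idm X) = f }.

Arguments idm {K l} X.
Notation "g \oc f" := (compm g f) (at level 40, left associativity).

Definition is_iso (K : fieldType) (A : lincat K) (X Y : A) (f : hom X Y) : Prop :=
  exists g : hom Y X, g \oc f = idm X /\ f \oc g = idm Y.

(* A linear action of the integers by shifts X |-> X[n], up to coherent
   isomorphisms X -> X[0] and X[i][j] -> X[i + j]. *)
Record shiftcat (K : fieldType) := Shiftcat {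
  sh_cat :> lincat K;
  sh : int -> sh_cat -> sh_cat;
  shm : forall n (X Y : sh_cat), hom X Y -> hom (sh n X) (sh n Y);
  shm_lin : forall n (X Y : sh_cat) a (f g : hom X Y),
    shm n (a *: f + g) = a *: shm n f + shm n g;
  shm1 : forall n (X : sh_cat), shm n (idm X) = idm (sh n X);
  shmM : forall n (X Y Z : sh_cat) (g : hom Y Z) (f : hom X Y),
    shm n (g \oc f) = shm n g \oc shm n f;
  sh0 : forall X : sh_cat, hom X (sh 0 X);
  shD : forall i j k : int, i + j = k ->
    forall X : sh_cat, hom (sh j (sh i X)) (sh k X);
  sh0_iso : forall X, is_iso (sh0 X);
  shD_iso : forall i j k (h : i + j = k) X, is_iso (shD h X);
  sh0_nat : forall (X Y : sh_cat) (f : hom X Y), shm 0 f \oc sh0 X = sh0 Y \oc f;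
  shD_nat : forall i j k (h : i + j = k) (X Y : sh_cat) (f : hom X Y),
    shm k f \oc shD h X = shD h Y \oc shm j (shm i f);
  shD0l : forall i (h : 0 + i = i) X, shD h X \oc shm i (sh0 X) = idm (sh i X);
  shD0r : forall i (h : i + 0 = i) X, shD h X \oc sh0 (sh i X) = idm (sh i X);
  shDA : forall i j k ij jk n (h1 : i + j = ij) (h2 : ij + k = n)
    (h3 : j + k = jk) (h4 : i + jk = n) X,
    shD h2 X \oc shm k (shD h1 X) = shD h4 X \oc shD h3 (sh i X) }.

Record tricat (K : fieldType) := Tricat {
  tri_cat :> shiftcat K;
  zero_ob : exists Z : tri_cat, idm Z = 0;
  biproducts : forall X Y : tri_cat, exists (S : tri_cat) (i : hom X S)
    (j : hom Y S) (p : hom S X) (q : hom S Y),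
    [/\ p \oc i = idm X, q \oc j = idm Y, p \oc j = 0, q \oc i = 0
      & i \oc p + j \oc q = idm S];
  distinguished : forall X Y Z : tri_cat,
    hom X Y -> hom Y Z -> hom Z (sh 1 X) -> Prop;
  dist_iso : forall (X Y Z X' Y' Z' : tri_cat) (f : hom X Y) (g : hom Y Z)
    (h : hom Z (sh 1 X)) (f' : hom X' Y') (g' : hom Y' Z') (h' : hom Z' (sh 1 X'))
    (u : hom X X') (v : hom Y Y') (w : hom Z Z'),
    is_iso u -> is_iso v -> is_iso w ->
    v \oc f = f' \oc u -> w \oc g = g' \oc v -> shm 1 u \oc h = h' \oc w ->
    distinguished f g h -> distinguished f' g' h';
  dist_id : forall X Z : tri_cat, idm Z = 0 ->
    distinguished (idm X) (0 : hom X Z) 0;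
  dist_cone : forall (X Y : tri_cat) (f : hom X Y),
    exists (Z : tri_cat) (g : hom Y Z) (h : hom Z (sh 1 X)), distinguished f g h;
  dist_rot : forall (X Y Z : tri_cat) (f : hom X Y) (g : hom Y Z)
    (h : hom Z (sh 1 X)), distinguished f g h <-> distinguished g h (- shm 1 f);
  dist_mor : forall (X Y Z X' Y' Z' : tri_cat) (f : hom X Y) (g : hom Y Z)
    (h : hom Z (sh 1 X)) (f' : hom X' Y') (g' : hom Y' Z') (h' : hom Z' (sh 1 X'))
    (u : hom X X') (v : hom Y Y'),
    distinguished f g h -> distinguished f' g' h' -> v \oc f = f' \oc u ->
    exists w : hom Z Z', w \oc g = g' \oc v /\ shm 1 u \oc h = h' \oc w;
  dist_oct : forall (X Y Z Z' X' Y' : tri_cat) (f : hom X Y) (g : hom Y Z)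
    (f1 : hom Y Z') (f2 : hom Z' (sh 1 X)) (g1 : hom Z X') (g2 : hom X' (sh 1 Y))
    (h1 : hom Z Y') (h2 : hom Y' (sh 1 X)),
    distinguished f f1 f2 -> distinguished g g1 g2 ->
    distinguished (g \oc f) h1 h2 ->
    exists (u : hom Z' Y') (v : hom Y' X'),
      [/\ distinguished u v (shm 1 f1 \oc g2), u \oc f1 = h1 \oc g, h2 \oc u = f2,
          v \oc h1 = g1 & g2 \oc v = shm 1 f \oc h2] }.

(* The graded algebra Hom(X, X[*]), with product a * b = a[j] o b for b of
   degree j. *)
Section GradedEnd.
Variables (K : fieldType) (A : shiftcat K) (X : A).

Definition gend : galg K.
Proof.
refine (@Galg K (fun k => hom X (sh k X))
  (fun i j k h a b => shD h X \oc shm j a \oc b) (sh0 X) _ _ _ _).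
- move=> i j k h; split=> a u v w; last first.
    by have [_ ->] := comp_bilin X (sh j X) (sh k X).
  rewrite shm_lin; have [_ ->] := comp_bilin (sh j X) (sh j (sh i X)) (sh k X).
  by have [-> _] := comp_bilin X (sh j X) (sh k X).
- move=> i j k ij jk n h1 h2 h3 h4 a b c.
  rewrite !shmM !compA; congr (_ \oc _ \oc _).
  by rewrite (shDA h1 h2 h3 h4) -!compA shD_nat.
- by move=> i h a; rewrite shD0l comp1m.
- by move=> i h a; rewrite -compA sh0_nat compA shD0r comp1m.
Defined.

End GradedEnd.

(* The shift by p is a Serre functor: isomorphisms from Hom(E, F) to the dual
   of Hom(F, E[p]), natural in E and F. *)
Definition calabi_yau (K : fieldType) (A : shiftcat K) (p : int) : Prop :=
  exists eta : forall E F : A, hom E F -> hom F (sh p E) -> K,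
    [/\ forall E F, bilin (eta E F : hom E F -> hom F (sh p E) -> K^o),
        forall E F (phi : hom F (sh p E) -> K),
          (forall a u v, phi (a *: u + v) = a * phi u + phi v) ->
          exists! f : hom E F, forall g, eta E F f g = phi g,
        forall (E' E F : A) (u : hom E' E) (f : hom E F) (g : hom F (sh p E')),
          eta E' F (f \oc u) g = eta E F f (shm p u \oc g)
      & forall (E F F' : A) (v : hom F F') (f : hom E F) (g : hom F' (sh p E)),
          eta E F' (v \oc f) g = eta E F f (g \oc v)].

(** ** Realization by dg-modules *)

(* Right dg-modules over B are (K, B)-bimodules. *)
Record perfmod (K : fieldType) (B : dga K) := Perfmod {
  pm_mod :> dgbimod (ground K) B;
  pm_perf : perfect pm_mod }.

Definition pm_shift (K : fieldType) (B : dga K) (P : perfmod B) : perfmod B :=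
  Perfmod (perfect_shift (pm_perf P)).

Definition pm_cone (K : fieldType) (B : dga K) (P Q : perfmod B)
    (f : dgmap P Q) : perfmod B :=
  Perfmod (perfect_cone f (pm_perf P) (pm_perf Q)).

(* An exact K-linear equivalence from the homotopy category of perfect
   (h-projective) right dg-modules over B, i.e. the perfect derived category of
   B, to A. It is given as a functor on closed degree 0 maps which is full and
   kills exactly the null-homotopic ones. *)
Record realization (K : fieldType) (A : tricat K) (B : dga K) := Realization {
  rz : perfmod B -> A;
  rzm : forall P Q : perfmod B, dgmap P Q -> hom (rz P) (rz Q);
  rzm_lin : forall (P Q : perfmod B) (a : K) (f g h : dgmap P Q),
    (forall i x, h i x = a *: f i x + g i x) -> rzm h = a *: rzm f + rzm g;
  rzm_id : forall P : perfmod B, rzm (dgmap_id P) = idm (rz P);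
  rzm_comp : forall (P Q S : perfmod B) (g : dgmap Q S) (f : dgmap P Q),
    rzm (dgmap_comp g f : dgmap P S) = rzm g \oc rzm f;
  rzm_full : forall (P Q : perfmod B) (u : hom (rz P) (rz Q)),
    exists f : dgmap P Q, rzm f = u;
  rzm_faithful : forall (P Q : perfmod B) (f : dgmap P Q),
    rzm f = 0 <-> null_homotopic f;
  rz_ess_surj : forall X : A, exists (P : perfmod B) (u : hom (rz P) X), is_iso u;
  rz_shift : forall P, hom (rz (pm_shift P)) (sh 1 (rz P));
  rz_shift_iso : forall P, is_iso (rz_shift P);
  rz_shift_nat : forall (P Q : perfmod B) (f : dgmap P Q),
    rz_shift Q \oc rzm (dgshift_map f : dgmap (pm_shift P) (pm_shift Q)) =
    shm 1 (rzm f) \oc rz_shift P;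
  rz_exact : forall (P Q : perfmod B) (f : dgmap P Q),
    distinguished (rzm f) (rzm (dgcone_in f : dgmap Q (pm_cone f)))
      (rz_shift P \oc rzm (dgcone_out f : dgmap (pm_cone f) (pm_shift P))) }.

(** * Grothendieck groups and rank functions *)

Section Grothendieck.
Variables (K : fieldType) (A : tricat K).

Definition free_ob := {freeg {classic A} / int}.
Definition free_cl (X : A) : free_ob := << (X : {classic A}) >>.

Definition K0 : lmodType int :=
  lquot [set x : free_ob | exists (X Y Z : A) (f : hom X Y) (g : hom Y Z)
    (h : hom Z (sh 1 X)),
    distinguished f g h /\ x = free_cl Y - free_cl X - free_cl Z].

Definition K0_cl (X : A) : K0 := lquot_pi _ (free_cl X).

Definition euler (E F : A) : int :=
  \sum_(k \in [set: int]) (-1) ^ k * (ldim (hom E (sh k F)))%:Z.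

(* The bilinear extension of [euler], computed on representatives in the free
   group on objects; it is additive on distinguished triangles, so the choice
   of representatives is irrelevant. *)
Definition eulerK0 (x y : K0) : int :=
  let a := repr x : free_ob in let b := repr y : free_ob in
  \sum_(E <- dom a) \sum_(F <- dom b) coeff E a * coeff F b * euler E F.

Definition Knum : lmodType int := lquot [set x : K0 | forall y, eulerK0 x y = 0].

Definition cl (X : A) : Knum := lquot_pi _ (K0_cl X).

(* The tensor product of Knum with K over the integers: the K-module with
   generators x (x) 1 and relations (x + y) (x) 1 = x (x) 1 + y (x) 1. *)
Definition KnumK : lmodType K :=
  lquot [set z : {freeg Knum / K} |
    exists x y : Knum, z = << x + y >> - << x >> - << y >>].

Definition tens1 (x : Knum) : KnumK := lquot_pi _ << x >>.

Definition cl_generates (U : set A) : Prop :=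
  forall z : KnumK, lspan [set tens1 (cl F) | F in U] z.

Record rank_function := RankFunction {
  rk :> A -> int;
  rk_dist : forall (X Y Z : A) (f : hom X Y) (g : hom Y Z) (h : hom Z (sh 1 X)),
    distinguished f g h -> rk Y = rk X + rk Z;
  rk_shift : forall F, rk (sh 1 F) = - rk F }.

Definition nontrivial_rank (r : rank_function) : Prop := exists F, r F != 0.

Definition numerical_rank (r : rank_function) : Prop :=
  exists rho : {additive Knum -> int}, forall F, r F = rho (cl F).

Definition unit_property (r : rank_function) (T : galg K) : Prop :=
  exists (i : forall (F : A) k, T k -> gend F k)
         (t : forall (F : A) k, gend F k -> T k),
    [/\ forall F, galg_mor (i F),
        forall (F G : A) k (a : T k) (psi : hom F G),
          shm k psi \oc (i F k a : hom F (sh k F)) =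
          (i G k a : hom G (sh k G)) \oc psi,
        forall F k c x y, t F k (c *: x + y) = c *: t F k x + t F k y
      & forall F k (a : T k), t F k (i F k a) = (r F)%:~R *: a].

Definition homological_unit (r : rank_function) (T : galg K) : Prop :=
  unit_property r T /\
  forall (T' : galg K) (f : forall k, T k -> T' k),
    unit_property r T' -> galg_mor f -> (forall k, injective (f k)) ->
    forall k, bijective (f k).

Definition unitary (T : galg K) : set A := [set F | gring_iso (gend F) T].

End Grothendieck.

Arguments unitary {K} A T.

(** * Hodge numbers *)

Definition hodge (K : fieldType) (B : dga K) (T : galg K) (p q : nat) : rat :=
  let h0 (i : nat) : rat := (ldim (T (3%:Z - i%:Z)))%:R in
  let hh (m : int) : rat := (dim_HH B m)%:R in
  let h11 := (hh 0 - h0 0%N - h0 0%N) / 2 in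
  let h21 := hh (- 1) - h0 1%N - h0 1%N in
  let h31 := hh (- 2) - h0 2%N in
  match maxn p q, minn p q with
  | 0, 0 | 3, 3 => h0 0
  | 1, 0 | 3, 2 => h0 1
  | 2, 0 => h0 2
  | 3, 0 => h0 3
  | 3, 1 => h31
  | 2, 1 => h21
  | 1, 1 | 2, 2 => h11
  | _, _ => 0%R
  end%N.

(* Main.v *)
Require Import Defs.
From mathcomp Require Import all_boot all_order all_algebra.
From mathcomp Require Import boolp classical_sets cardinality fsbigop reals.
From mathcomp Require Import complex freeg.
Local Open Scope ring_scope.

(* Both sets of Hodge numbers are computed from the same Hochschild homology, so
   it suffices that T1 and T2 have the same dimension in each degree. If the rank
   of F is nonzero, then t_F o i_F is an invertible scalar, and i_F embeds the
   unit T into Hom(F, F[*]). As the classes of the unitary objects for T' generate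
   and the rank is nonzero and numerical, F can be chosen unitary for T', which
   gives dim T^k <= dim T'^k. In part 1 this applies in both directions. In part 2
   it bounds T2 by C + C[3], the unit gives T2^0 = C, and Serre duality on a
   unitary object for T2 gives dim T2^3 = dim T2^0.
   Two points need care. Unitarity only provides isomorphisms of graded rings,
   which preserve dimensions because C is algebraically closed. Finite
   dimensionality of the Hom spaces comes from the Calabi-Yau property: as the
   shift is fully faithful, the Serre pairing identifies each of Hom(E, F) and
   Hom(F, E[3]) with the full dual of the other. *)

Set Implicit Arguments.
Unset Strict Implicit.
Unset Printing Implicit Defensive.
Import Order.TTheory GRing.Theory Num.Theory.

(** * Bases and dimension of vector spaces *)

Section LinearAlgebra.
Local Open Scope classical_set_scope.
Variable K : fieldType.
Implicit Types V W : lmodType K.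

Definition linear_map V W (f : V -> W) :=
  forall a x y, f (a *: x + y) = a *: f x + f y.

Definition dim_eq V n := has_dim [set: V] [set 0] n.

Definition comb V n (v : 'I_n -> V) (c : 'rV[K]_n) := \sum_i c 0 i *: v i.

Definition indep V n (v : 'I_n -> V) := forall c, comb v c = 0 -> c = 0.

Definition spanning V n (v : 'I_n -> V) := forall z, exists c, z = comb v c.

Lemma lin_sum V W (f : V -> W) : linear_map f ->
  forall n (c : 'rV[K]_n) (v : 'I_n -> V), f (comb v c) = comb (f \o v) c.
Proof.
move=> fl n c v; have f0 := lin0 fl; rewrite /comb.
elim/big_rec2: _ => // i y x _ <-; exact: fl.
Qed.

Lemma comb_lin V n (v : 'I_n -> V) : linear_map (comb v).
Proof.
move=> a x y; rewrite /comb scaler_sumr -big_split; apply: eq_bigr => i _ /=.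
by rewrite !mxE scalerDl scalerA.
Qed.

Lemma comb_mulmx V m n (v : 'I_n -> V) (M : 'M[K]_(m, n)) c :
  comb (fun i => comb v (row i M)) c = comb v (c *m M).
Proof.
rewrite /comb; under eq_bigr => i _ do rewrite scaler_sumr.
rewrite exchange_big; apply: eq_bigr => j _ /=.
rewrite mxE scaler_suml; apply: eq_bigr => i _.
by rewrite !mxE scalerA.
Qed.

Lemma indep_inj V n (v : 'I_n -> V) : indep v -> injective (comb v).
Proof.
move=> iv c d e; apply/eqP; rewrite -subr_eq0; apply/eqP/iv.
by rewrite -scaleN1r addrC comb_lin e scaleN1r addNr.
Qed.

Lemma dim_eqI V n (v : 'I_n -> V) : indep v -> spanning v -> dim_eq V n.
Proof.
move=> iv sv; exists v; split=> // z _; have [c zc] := sv z.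
exists c; split=> [|d /eqP]; first by rewrite /= zc subrr.
by rewrite subr_eq0 zc => /eqP /(indep_inj iv).
Qed.

Lemma dim_eq_basis V n : dim_eq V n -> exists2 v : 'I_n -> V, indep v & spanning v.
Proof.
move=> [v [_ Hv]]; exists v => [c c0|z].
  have [d [_ dU]] := Hv 0 I; rewrite -[LHS](dU c); last by rewrite /= -/(comb v c) c0 subrr.
  by apply: dU; rewrite /= -/(comb v 0) (lin0 (comb_lin v)) subrr.
by have [c [/eqP]] := Hv z I; rewrite subr_eq0 => /eqP zc _; exists c.
Qed.

(** A row in the left kernel of the coordinate matrix of [u] in terms of [s] is a relation among the
    vectors of [u]. Hence this matrix has full row rank. *)
Lemma indep_le_spanning V m n (s : 'I_m -> V) (u : 'I_n -> V) :
  spanning s -> indep u -> (n <= m)%N.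
Proof.
move=> ss iu.
have [M HM] : exists M : 'M[K]_(n, m), forall i, u i = comb s (row i M).
  have [c Hc] := choice (fun i => ss (u i)).
  by exists (\matrix_i c i) => i; rewrite rowK.
suff : row_free M by move=> /eqP <-; apply: rank_leq_col.
rewrite -kermx_eq0; apply/eqP/row_matrixP => i; rewrite row0; apply: iu.
transitivity (comb s (row i (kermx M) *m M)); last first.
  by rewrite -row_mul mulmx_ker row0 (lin0 (comb_lin s)).
by rewrite -comb_mulmx; apply: eq_bigr => j _; rewrite HM.
Qed.

Lemma dim_eq_uniq V m n : dim_eq V m -> dim_eq V n -> m = n.
Proof.
move=> /dim_eq_basis[u iu su] /dim_eq_basis[v iv sv].
by apply/eqP; rewrite eqn_leq (indep_le_spanning sv iu) (indep_le_spanning su iv).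
Qed.

Lemma ldimE V n : dim_eq V n -> ldim V = n.
Proof.
move=> dV; rewrite /ldim /qdim; case: xgetP => [m _ dm|/(_ n)] //.
exact: dim_eq_uniq dm dV.
Qed.

(** The value 0 of [ldim] is ambiguous, being also the default in infinite dimension; a nonzero
    value certifies a basis. *)
Lemma ldim_neq0 V : (ldim V != 0)%N -> dim_eq V (ldim V).
Proof. by rewrite /ldim /qdim; case: xgetP. Qed.

Lemma maximal_indep V (P : set V) m :
  (forall n (u : 'I_n -> V), (forall i, P (u i)) -> indep u -> (n <= m)%N) ->
  exists n, exists u : 'I_n -> V,
    [/\ forall i, P (u i), indep u & forall z, P z -> exists c, z = comb u c].
Proof.
move=> bnd.
pose Q n := `[< exists u : 'I_n -> V, (forall i, P (u i)) /\ indep u >].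
have Q0 : exists n, Q n.
  exists 0%N; apply/asboolP; exists (fun=> 0); split=> [[]//|c _].
  by apply/rowP => -[].
have Qm n : Q n -> (n <= m)%N by move=> /asboolP[u []]; apply: bnd.
case: (ex_maxnP Q0 Qm) => n /asboolP[u [Pu iu]] nmax.
exists n, u; split=> // z Pz.
pose w (i : 'I_n.+1) := if unlift ord_max i is Some j then u j else z.
have combw c : comb w c =
    comb u (\row_i c 0 (fintype.lift ord_max i)) + c 0 ord_max *: z.
  rewrite /comb (bigD1_ord ord_max) //= addrC /w unlift_none; congr (_ + _).
  by apply: eq_bigr => i _; rewrite liftK mxE.
have [iw|] := pselect (indep w).
  suff /nmax : Q n.+1 by rewrite ltnn.
  by apply/asboolP; exists w; split=> // i; rewrite /w; case: unliftP.
move=> /existsNP[c /not_implyP[]]; rewrite combw => cw c_neq0.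
have [cm|cm] := eqVneq (c 0 ord_max) 0.
  case: c_neq0; apply/rowP => i; rewrite mxE.
  move: cw; rewrite cm scale0r addr0 => /iu/rowP cu.
  case: (unliftP ord_max i) => [j|] -> //.
  by have := cu j; rewrite !mxE.
exists (- (c 0 ord_max)^-1 *: (\row_i c 0 (fintype.lift ord_max i))).
rewrite (linZ (comb_lin u)); move/eqP: cw; rewrite addr_eq0 => /eqP ->.
by rewrite scaleNr scalerN opprK scalerA mulVf // scale1r.
Qed.

Lemma bounded_indep_dim V m :
  (forall n (u : 'I_n -> V), indep u -> (n <= m)%N) ->
  exists2 n, (n <= m)%N & dim_eq V n.
Proof.
move=> bnd; have [|n [u [_ iu su]]] := @maximal_indep V setT m.
  by move=> n u _; apply: bnd.
by exists n; [exact: bnd iu|apply: dim_eqI iu _ => z; apply: su].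
Qed.

Lemma indep_comp V W (f : V -> W) n (v : 'I_n -> V) :
  linear_map f -> injective f -> indep v -> indep (f \o v).
Proof.
move=> fl fi iv c; rewrite -lin_sum // -(lin0 fl) => /fi; exact: iv.
Qed.

Lemma dim_le V W (f : V -> W) m :
  linear_map f -> injective f -> dim_eq W m -> exists2 n, (n <= m)%N & dim_eq V n.
Proof.
move=> fl fi /dim_eq_basis[w _ sw]; apply: bounded_indep_dim => n u iu.
exact: indep_le_spanning sw (indep_comp fl fi iu).
Qed.

Lemma dim_eq_iso V W (f : V -> W) n :
  linear_map f -> bijective f -> dim_eq V n -> dim_eq W n.
Proof.
move=> fl [g gK fK] /dim_eq_basis[v iv sv].
apply: (dim_eqI (indep_comp fl (can_inj gK) iv)) => z.
by have [c gz] := sv (g z); exists c; rewrite -lin_sum // -gz fK.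
Qed.

Lemma dim_eq0 V : dim_eq V 0 -> forall x : V, x = 0.
Proof.
by move=> /dim_eq_basis[v _ sv] x; have [c ->] := sv x; rewrite /comb big_ord0.
Qed.

Lemma eq0_dim V : (forall x : V, x = 0) -> dim_eq V 0.
Proof.
move=> V0; apply: (@dim_eqI _ _ (fun=> 0)) => [c _|z].
  by apply/rowP => -[].
by exists 0; rewrite [LHS]V0 [RHS]V0.
Qed.

(** * Separating functionals and infinite-dimensional spaces *)

Definition submod V (S : set V) :=
  S 0 /\ forall a u v, S u -> S v -> S (a *: u + v).

Lemma submodZ V (S : set V) a u : submod S -> S u -> S (a *: u).
Proof. by case=> S0 SD Su; rewrite -[a *: u]addr0; apply: SD. Qed.

Lemma submodB V (S : set V) u v : submod S -> S u -> S v -> S (u - v).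
Proof. by case=> _ SD Su Sv; rewrite -scaleN1r addrC; apply: SD. Qed.

(** Zorn gives a submodule [H] containing [S] and maximal for avoiding [x]. If [y] is outside [H],
    maximality puts [x] in [H + K y]; so every vector is congruent modulo [H] to a multiple of [x],
    whose unique coefficient is the functional. *)
Lemma separation V (S : set V) x : submod S -> ~ S x ->
  exists phi : V -> K^o, [/\ linear_map phi, forall s, S s -> phi s = 0 & phi x = 1].
Proof.
move=> Ssub Sx.
(* The empty set is allowed because Zorn_bigcup also tests the empty chain. *)
pose P (H : set V) := H = set0 \/ [/\ submod H, S `<=` H & ~ H x].
have [F FP Ftot|H [[H0|[Hsub SH Hx]] Hmax]] := @Zorn_bigcup V P.
- have [FE|] := pselect (exists H, F H /\ H <> set0); last first.
    move=> /forallNP FE; left; apply/seteqP; split=> // y [H FH Hy].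
    by case: (FE H); split=> // H0; rewrite H0 in Hy.
  case: FE => H [FH Hn0]; right.
  have FS G : F G -> G <> set0 -> [/\ submod G, S `<=` G & ~ G x].
    by move=> /FP[].
  split.
  + split.
      by exists H => //; have [[]] := FS H FH Hn0.
    move=> a u v [Hu Fu uH] [Hv Fv vH].
    have nu : Hu <> set0 by move=> e; rewrite e in uH.
    have nv : Hv <> set0 by move=> e; rewrite e in vH.
    have [[_ HuD] _ _] := FS Hu Fu nu; have [[_ HvD] _ _] := FS Hv Fv nv.
    have [sub|sub] := Ftot _ _ Fu Fv.
      by exists Hv => //; apply: HvD => //; apply: sub.
    by exists Hu => //; apply: HuD => //; apply: sub.
  + by move=> s Ss; exists H => //; have [_ SH _] := FS H FH Hn0; apply: SH.
  + move=> [G FG Gx]; have nG : G <> set0 by move=> e; rewrite e in Gx.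
    by have [_ _] := FS G FG nG.
- case: (Hmax S); last by right; split.
  by rewrite H0; split=> // S0; case: Ssub => /S0.
have dec y : exists c : K, H (y - c *: x).
  have [Hy|Hy] := pselect (H y); first by exists 0; rewrite scale0r subr0.
  pose G := [set z | exists (a : K) (h : V), H h /\ z = a *: y + h].
  have Gsub : submod G.
    have [H0 HD] := Hsub; split; first by exists 0, 0; rewrite scale0r addr0.
    move=> a u v [b [h [Hh ->]]] [b' [h' [Hh' ->]]].
    exists (a * b + b'), (a *: h + h'); split; first exact: HD.
    by rewrite scalerDr scalerDl scalerA addrACA.
  have HG : H `<=` G by move=> h Hh; exists 0, h; rewrite scale0r add0r.
  have [Gx|Gx] := pselect (G x); last first.
    case: (Hmax G); last by right; split=> //; apply: subset_trans HG.
    split=> // GH; apply: Hy; apply: GH; exists 1, 0.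
    by rewrite scale1r addr0; have [] := Hsub.
  have [a [h [Hh xE]]] := Gx.
  have a0 : a != 0.
    by apply/eqP => a0; apply: Hx; rewrite xE a0 scale0r add0r.
  exists a^-1; rewrite [in X in _ - _ *: X]xE scalerDr scalerA mulVf // scale1r.
  by rewrite opprD addNKr -scalerN; apply: submodZ => //; rewrite -sub0r; apply: submodB => //; case: Hsub.
have uniq y c d : H (y - c *: x) -> H (y - d *: x) -> c = d.
  move=> Hc Hd; have := submodB Hsub Hd Hc.
  rewrite opprB addrC subrKA -scalerBl => Hcd; apply/eqP; rewrite -subr_eq0.
  apply/eqP; apply: contra_notP Hx => /eqP cd.
  by have := submodZ (c - d)^-1 Hsub Hcd; rewrite scalerA mulVf // scale1r.
have [phi Hphi] := choice dec; exists phi; split=> [a u v|s Ss|].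
- apply: (uniq (a *: u + v) _ (a * phi u + phi v)) => //.
  rewrite scalerDl opprD addrACA -scalerA -scalerBr.
  by have [_ HD] := Hsub; apply: HD.
- by apply: (uniq s) => //; rewrite scale0r subr0; apply: SH.
- by apply: (uniq x) => //; rewrite scale1r subrr; case: Hsub.
Qed.

Lemma lspan_comb V (s : seq V) z : lspan [set x | x \in s] z ->
  exists c : 'rV[K]_(size s), z = comb (fun i => nth 0 s i) c.
Proof.
elim=> [|a u v /= us _ [c ->]]; first by exists 0; rewrite (lin0 (comb_lin _)).
have us' : (index u s < size s)%N by rewrite index_mem.
exists (a *: delta_mx 0 (Ordinal us') + c); rewrite comb_lin; congr (_ *: _ + _).
rewrite /comb (bigD1 (Ordinal us')) //= big1 => [|i /negbTE ni].
  by rewrite mxE !eqxx scale1r addr0 nth_index.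
by rewrite mxE ni scale0r.
Qed.

(* The polynomials serve as a concrete space of countably infinite dimension. *)
Lemma infinite_dim V : (forall n, ~ dim_eq V n) ->
  exists2 L : {poly K} -> V, linear_map L & injective L.
Proof.
move=> Vinf.
have ext (s : seq V) : exists v, ~ lspan [set x | x \in s] v.
  apply: contrapT => /forallNP Hs.
  have [n u iu|n _ /Vinf //] := @bounded_indep_dim V (size s).
  apply: (indep_le_spanning (s := fun i : 'I_(size s) => nth 0 s i)) iu => z.
  by apply: lspan_comb; apply: contrapT.
have [pick pickP] := choice ext.
(* [b n] lists the first [n] chosen vectors, and the next vector [v n] is chosen outside their
   span. *)
pose b := fix b n := if n is m.+1 then rcons (b m) (pick (b m)) else [::].
pose v n := pick (b n).
have vb i n : (i < n)%N -> v i \in b n.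
  elim: n => // n IH; rewrite ltnS leq_eqVlt mem_rcons inE => /predU1P[->|/IH->].
    by rewrite eqxx.
  by rewrite orbT.
pose L (p : {poly K}) := \sum_(i < size p) p`_i *: v i.
have LE (p : {poly K}) n : (size p <= n)%N -> L p = \sum_(i < n) p`_i *: v i.
  move=> pn; rewrite /L (big_ord_widen n (fun i => p`_i *: v i) pn).
  rewrite [RHS](bigID (fun i : 'I_n => (i < size p)%N)) /= [X in _ + X]big1 ?addr0 //.
  by move=> i; rewrite -leqNgt => pi; rewrite nth_default ?scale0r.
have Llin : linear_map L.
  move=> a p q; pose n := maxn (size (a *: p + q)) (maxn (size p) (size q)).
  rewrite !(LE _ n) ?leq_max ?leqnn ?orbT //.
  rewrite scaler_sumr -big_split; apply: eq_bigr => i _ /=.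
  by rewrite coefD coefZ scalerDl scalerA.
exists L => // p q Lpq; apply/eqP; rewrite -subr_eq0; apply: contraT => pq0.
have : L (p - q) = 0 by rewrite -scaleN1r addrC Llin Lpq scaleN1r addNr.
move: (p - q) pq0 => {Lpq p q} p p0; rewrite /L.
have := p0; rewrite -lead_coef_eq0 /lead_coef.
move: p0; rewrite -size_poly_gt0; case: (size p) => // n _ /= pn0.
(* The top coefficient is invertible, so the relation would put [v n] in the span of [b n]. *)
rewrite big_ord_recr /= => /eqP; rewrite addrC addr_eq0 => /eqP vn.
case: (pickP (b n)); rewrite -/(v n) -[v n]scale1r -(mulVf pn0) -scalerA vn.
apply/lspan_scale/lspan_opp; elim/big_rec: _ => [|i x _ Sx]; first exact: lspan0.
by apply: lspanD => //=; apply: vb.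
Qed.

(** * Pairings that represent all linear functionals *)

Section Pairing.
Variables (V W : lmodType K) (eta : V -> W -> K^o).
Hypothesis eta_bilin : bilin eta.
Hypothesis functional_l : forall phi : W -> K^o, linear_map phi ->
  exists v, forall w, eta v w = phi w.
Hypothesis functional_r : forall phi : V -> K^o, linear_map phi ->
  exists w, forall v, eta v w = phi v.

(* In an infinite-dimensional V, let Y_n be the image of the multiples of 'X^n
   and let w induce evaluation at 1 there. The union of the orthogonals of the
   Y_n does not contain w, but a vector v separating it from w would lie in every
   Y_n, hence vanish. *)
Lemma pairing_fin_dim : exists n, dim_eq V n.
Proof.
apply: contrapT => /forallNP /infinite_dim[L Llin Linj].
(* [phi] extends evaluation at 1 from the image of [L] to all of [V]. *)
have [phi [philin phi0 phi1]] : exists phi : V -> K^o, [/\ linear_map phi,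
    forall s, (exists q, s = L (('X - 1%:P) * q)) -> phi s = 0 & phi (L 1) = 1].
  apply: separation.
    split; first by exists 0; rewrite mulr0 (lin0 Llin).
    move=> a u v [q ->] [r ->]; exists (a *: q + r).
    by rewrite mulrDr -scalerAr Llin.
  move=> [q /Linj /(congr1 (fun p : {poly K} => p.[1]))].
  by rewrite !hornerE subrr mul0r => /eqP; rewrite oner_eq0.
have [w Hw] := functional_r philin.
have wX n : eta (L 'X^n) w = 1.
  have /factor_theorem[q /eqP] : root ('X^n - 1 : {poly K}) 1.
    by rewrite /root !hornerE expr1n subrr.
  rewrite subr_eq => /eqP ->; rewrite Hw -[q * _]scale1r Llin philin phi1.
  by rewrite phi0 ?scaler0 ?add0r //; exists q; rewrite mulrC.
(* The union of the orthogonals is a submodule because it is increasing: the multiples of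
   ['X^(m + n)] are among those of ['X^m] and of ['X^n]. *)
pose E := [set x : W | exists n, forall q, eta (L ('X^n * q)) x = 0].
have [||Phi [Philin PhiE Phi1]] := @separation W E w.
- split; first by exists 0%N => q; rewrite (bilin0r _ eta_bilin).
  move=> a x y [m Hx] [n Hy]; exists (m + n)%N => q.
  have [_ ->] := eta_bilin; rewrite {1}exprD -mulrA Hx scaler0 add0r.
  by rewrite addnC exprD -mulrA Hy.
- move=> [n /(_ 1)]; rewrite mulr1 wX => /eqP; by rewrite oner_eq0.
have [v Hv] := functional_l Philin.
(* Otherwise some [x] in [W] pairs to 0 with the image of the multiples of ['X^n] and to 1 with [v].
   Such an [x] lies in [E], where pairing with [v] is zero. *)
have vY n : exists q, v = L ('X^n * q).
  apply: contrapT => nv.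
  have [||psi [psilin psi0 psi1]] := @separation V [set x | exists q, x = L ('X^n * q)] v.
  + split; first by exists 0; rewrite mulr0 (lin0 Llin).
    move=> a x y [q ->] [r ->]; exists (a *: q + r).
    by rewrite mulrDr -scalerAr Llin.
  + exact: nv.
  have [x Hx] := functional_r psilin.
  have : Phi x = 0 by apply: PhiE; exists n => q; rewrite Hx; apply: psi0; exists q.
  by rewrite -Hv Hx psi1 => /eqP; rewrite oner_eq0.
have [p vp] := vY 0%N.
have v0 : v = 0.
  (* A nonzero polynomial [p] is not a multiple of ['X^(size p)], for degree reasons. *)
  have [q vq] := vY (size p); move: vp; rewrite mul1r vq => /Linj pE.
  have [q0|q0] := eqVneq q 0; first by rewrite q0 mulr0 (lin0 Llin).
  have := size_monicM (monicXn K (size p)) q0; rewrite pE size_polyXn => pq.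
  by case/eqP: q0; apply/eqP; rewrite -size_poly_eq0 -(eqn_add2l (size p)) addn0 {2}pq addSn.
by move: Phi1; rewrite -Hv v0 (bilin0l _ eta_bilin) => /eqP; rewrite eq_sym oner_eq0.
Qed.

Hypothesis nondegenerate_l : forall v, (forall w, eta v w = 0) -> v = 0.
Hypothesis nondegenerate_r : forall w, (forall v, eta v w = 0) -> w = 0.

(** Representing the coordinate functionals of a basis of [V] gives a dual family in [W]; it spans
    because only 0 is orthogonal to that basis. *)
Lemma pairing_dim n : dim_eq V n -> dim_eq W n.
Proof.
move=> /dim_eq_basis[v iv sv].
have lr c w : eta (comb v c) w = \sum_i c 0 i * eta (v i) w.
  by rewrite (@lin_sum V K^o (eta^~ w)) // => a x y; case: eta_bilin => ->.
have [co coP] := choice sv.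
have col : linear_map co.
  by move=> a x y; apply: (indep_inj iv); rewrite comb_lin -!coP.
have [w Hw] : exists w : 'I_n -> W, forall i j, eta (v i) (w j) = (i == j)%:R.
  suff /choice[w Hw] : forall j, exists w, forall i, eta (v i) w = (i == j)%:R.
    by exists w.
  move=> j; have [|w Hw] := @functional_r (fun x => co x 0 j).
    by move=> a x y; rewrite col !mxE.
  exists w => i; rewrite Hw.
  suff -> : co (v i) = delta_mx 0 i by rewrite !mxE eq_sym.
  apply: (indep_inj iv); rewrite -coP /comb (bigD1 i) //= mxE !eqxx scale1r.
  by rewrite big1 ?addr0 // => k /negbTE ki; rewrite mxE ki scale0r.
have wr i c : eta (v i) (comb w c) = c 0 i.
  rewrite (@lin_sum W K^o (eta (v i))); last by move=> a x y; case: eta_bilin => _ ->.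
  rewrite /comb (bigD1 i) //= Hw eqxx big1 => [|k ki].
    by rewrite addr0 -[LHS]/(_ * _) mulr1.
  by rewrite Hw eq_sym (negbTE ki) scaler0.
apply: (dim_eqI (v := w)) => [c c0|z].
  by apply/rowP => i; rewrite -wr c0 mxE (bilin0r _ eta_bilin).
exists (\row_i eta (v i) z); apply/eqP; rewrite -subr_eq0; apply/eqP.
apply: nondegenerate_r => x; have [c ->] := sv x; rewrite lr big1 // => i _.
rewrite -scaleN1r addrC; have [_ ->] := eta_bilin.
by rewrite wr mxE -[-1 *: _]/(-1 * _) mulN1r addNr mulr0.
Qed.

End Pairing.
End LinearAlgebra.

(** * Dimension under additive bijections between vector spaces *)

(* Two module structures over an algebraically closed field which commute: the
   operators of the first, being commuting and linear for the second, can be put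
   in triangular form, and a triangular basis stays independent over the first. *)
Section CommutingActions.
Variables (C : numClosedFieldType) (V W : lmodType C) (f : V -> W).
Hypothesis f_add : {morph f : x y / x + y}.
(** Commutation of the two actions, written without the inverse of [f]: the scalar [a] of [V],
    transported to [W], sends [b *: f u] to [b] times the image of [f u]. *)
Hypothesis f_comm : forall a b u v, f v = b *: f u -> f (a *: v) = b *: f (a *: u).

Lemma commuting_actions_dim_le m n : bijective f ->
  dim_eq V m -> dim_eq W n -> (n <= m)%N.
Proof.
move=> [g gK fK] /dim_eq_basis[v iv sv] /dim_eq_basis[w iw sw].
have f0 : f 0 = 0 by apply: (addrI (f 0)); rewrite -f_add !addr0.
pose act a x := f (a *: g x).
have actl a : linear_map (act a).
  move=> b x y; rewrite /act.
  have -> : g (b *: x + y) = g (b *: x) + g y.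
    by apply: (can_inj gK); rewrite f_add !fK.
  by rewrite scalerDr f_add; congr (_ + _); apply: f_comm; rewrite !fK.
have actD a b x : act (a + b) x = act a x + act b x.
  by rewrite /act scalerDl f_add.
have actM a b x : act a (act b x) = act (a * b) x by rewrite /act gK scalerA.
have act1 x : act 1 x = x by rewrite /act scale1r fK.
have [A HA] : exists A : C -> 'M[C]_n, forall a c, act a (comb w c) = comb w (c *m A a).
  have /choice[A HA] : forall a, exists A : 'M[C]_n, forall i, act a (w i) = comb w (row i A).
    move=> a; have [c Hc] := choice (fun i => sw (act a (w i))).
    by exists (\matrix_i c i) => i; rewrite rowK.
  exists A => a c; rewrite -comb_mulmx lin_sum //; apply: eq_bigr => i _ /=.
  by rewrite HA.
have A_inj (M N : 'M[C]_n) : (forall c : 'rV_n, comb w (c *m M) = comb w (c *m N)) -> M = N.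
  move=> MN; apply/row_matrixP => i; rewrite !rowE; apply: (indep_inj iw); exact: MN.
have AM a b : A a *m A b = A (b * a).
  by apply: A_inj => c; rewrite mulmxA -!HA actM.
have AD a b : A (a + b) = A a + A b.
  apply: A_inj => c; rewrite mulmxDr (linD (comb_lin w)) -!HA.
  exact: actD.
have A0 : A 0 = 0 by apply: (addrI (A 0)); rewrite -AD !addr0.
have A1 : A 1 = 1%:M by apply: A_inj => c; rewrite -HA act1 mulmx1.
(* Simultaneous triangularization takes a finite list of matrices, so the family [A] is replaced by
   finitely many members spanning all of it. *)
have [k [B [BA _ AB]]] : exists k, exists B : 'I_k -> 'M[C]_n,
    [/\ forall i, range A (B i), indep B & forall M, range A M -> exists c, M = comb B c].
  apply: (@maximal_indep _ _ _ (n * n)) => l u _ iu.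
  apply: (@indep_le_spanning _ 'rV[C]_(n * n) _ _ (fun i => delta_mx 0 i) (mxvec \o u)).
    move=> z; exists z; rewrite /comb [LHS]row_sum_delta.
    by [].
  apply: indep_comp iu; first by move=> a x y; exact: linearP.
  exact: (can_inj mxvecK).
have [|P /unitarymx_unit Pu /allP /= trigP] := @cotrigonalization _ n [seq B i | i : 'I_k].
  move=> _ _ /mapP[i _ ->] /mapP[j _ ->].
  by case: (BA i) => a _ <-; case: (BA j) => b _ <-; rewrite /comm_mx !AM mulrC.
pose T a := P *m A a *m invmx P.
have Ttrig a (i j : 'I_n) : (i < j)%N -> T a i j = 0.
  move=> ij; have [|c] := AB (A a); first by exists a.
  rewrite /T => ->; rewrite mulmx_sumr mulmx_suml summxE big1 // => l _.
  rewrite -scalemxAr -scalemxAl mxE.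
  have := trigP (B l); rewrite fintype.image_f // => /(_ isT).
  by rewrite /similar_to conjumx // => /is_trig_mxP/(_ i j ij) ->; rewrite mulr0.
(* For nonzero [a] the triangular matrix [T a] has inverse [T a^-1], so no diagonal entry
   vanishes. *)
have Tdiag a (i : 'I_n) : T a i i = 0 -> a = 0.
  move=> Ti; apply/eqP; apply: contraT => a0.
  have : T a *m T a^-1 = 1%:M.
    rewrite /T !mulmxA mulmxKV // -[_ *m A a *m _]mulmxA AM mulVf // A1 mulmx1.
    by rewrite mulmxV.
  move=> /(congr1 determinant); rewrite det_mulmx det1 det_trig; last first.
    by apply/is_trig_mxP => r s; apply: Ttrig.
  by rewrite (bigD1 i) //= Ti !mul0r => /eqP; rewrite eq_sym oner_eq0.
pose u i := comb w (row i P).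
have actu a i : act a (u i) = comb u (row i (T a)).
  rewrite /u HA (comb_mulmx w P); congr comb.
  by rewrite -!row_mul /T mulmxKV.
apply: (indep_le_spanning (u := g \o u) sv) => c c0.
have fsum l (x : 'I_l -> V) : f (\sum_i x i) = \sum_i f (x i).
  by elim/big_rec2: _ => // i _ y _ <-; rewrite f_add.
(* Under [f], the relation with coefficients [c] among the [g (u i)] becomes a vanishing sum of the
   [act (c 0 i) (u i)]; this is its [j]-th coordinate in the family [u]. *)
have sumT j : \sum_i T (c 0 i) i j = 0.
  have iu : indep u.
    move=> d; rewrite /u comb_mulmx => /iw /(congr1 (mulmx^~ (invmx P))).
    by rewrite mulmxK // mul0mx.
  have : comb u (\sum_i row i (T (c 0 i))) = 0.
    transitivity (\sum_i comb u (row i (T (c 0 i)))).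
      elim/big_rec2: _ => [|i _ y _ <-]; first exact: lin0 (comb_lin u).
      exact: linD (comb_lin u) _ _.
    transitivity (\sum_i act (c 0 i) (u i)); first by apply: eq_bigr => i _; rewrite actu.
    by transitivity (f (comb (g \o u) c)); [rewrite fsum|rewrite c0 f0].
  move=> /iu/rowP/(_ j); rewrite summxE [RHS]mxE => e; rewrite -[RHS]e.
  by apply: eq_bigr => i _; rewrite [RHS]mxE.
apply/rowP => i; rewrite mxE.
(* Descending induction on [i]: in [sumT i] the terms with [j < i] vanish by triangularity and those
   with [j > i] because [c 0 j] is already 0, which leaves the diagonal term. *)
have [l] := ubnP (n - i); elim: l i => // l IH i nil.
apply: (Tdiag _ i); rewrite -[RHS](sumT i) (bigD1 i) //= big1 ?addr0 // => j ji.
have [lt|lt|/val_inj e] := ltngtP j i; first exact: Ttrig.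
  rewrite IH; first by rewrite /T A0 mulmx0 mul0mx mxE.
  exact: leq_trans (ltn_sub2l (ltn_ord i) lt) nil.
by rewrite e eqxx in ji.
Qed.

End CommutingActions.

(** The commutation hypothesis is symmetric in the two actions, so the inequality applies to [f] and
    to its inverse. *)
Lemma commuting_actions_dim (C : numClosedFieldType) (V W : lmodType C) (f : V -> W) m n :
  {morph f : x y / x + y} ->
  (forall a b u v, f v = b *: f u -> f (a *: v) = b *: f (a *: u)) ->
  bijective f -> dim_eq V m -> dim_eq W n -> m = n.
Proof.
move=> fD fC fB dV dW; apply/eqP; rewrite eqn_leq.
rewrite (commuting_actions_dim_le fD fC fB dV dW) andbT.
have [g gK fK] := fB.
apply: (commuting_actions_dim_le (f := g)) dW dV.
- by move=> x y; apply: (can_inj gK); rewrite fD !fK.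
- move=> a b u v gv; apply: (can_inj gK); rewrite fK.
  by rewrite (fC b a (g u) (g (a *: u))) -?gv !fK.
- by exists f.
Qed.

(** * Full faithfulness of the shift and Serre duality *)

Section Isomorphisms.
Local Notation hom := Defs.hom.
Variables (K : fieldType) (A : lincat K).

Lemma iso_epi (X Y Z : A) (u : hom X Y) (f g : hom Y Z) :
  is_iso u -> f \oc u = g \oc u -> f = g.
Proof.
by move=> [w [_ uw]] /(congr1 (fun h => h \oc w)); rewrite -!Defs.compA uw !compm1.
Qed.

Lemma iso_mono (X Y Z : A) (u : hom Y Z) (f g : hom X Y) :
  is_iso u -> u \oc f = u \oc g -> f = g.
Proof.
by move=> [w [wu _]] /(congr1 (fun h => w \oc h)); rewrite !Defs.compA wu !comp1m.
Qed.

End Isomorphisms.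

Section Shift.
Local Notation hom := Defs.hom.
Variables (K : fieldType) (A : shiftcat K).

(** Shifting by [n] and then by [- n] is naturally isomorphic to the identity, through [shD] and
    [sh0]. This gives faithfulness here and a preimage in [shm_surj]. *)
Lemma shm_inj n (X Y : A) : injective (@shm K A n X Y).
Proof.
move=> f g fg; have h : n + - n = 0 by rewrite subrr.
apply: (iso_mono (sh0_iso Y)); rewrite -!sh0_nat; congr (_ \oc _).
by apply: (iso_epi (shD_iso h X)); rewrite !shD_nat fg.
Qed.

Lemma shm_surj n (X Y : A) (g : hom (sh n X) (sh n Y)) : exists f, shm n f = g.
Proof.
have h : n + - n = 0 by rewrite subrr.
have [s [ss' s's]] := sh0_iso X; have [s' [s'0 s0']] := sh0_iso Y.
have [d [dd' d'd]] := shD_iso h X.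
exists (s' \oc shD h Y \oc shm (- n) g \oc d \oc sh0 X).
apply: (@shm_inj (- n)); apply: (iso_mono (shD_iso h Y)).
rewrite -shD_nat; set f := (X in shm 0 X).
have <- : sh0 Y \oc f \oc s = shm 0 f by rewrite -sh0_nat -Defs.compA s's compm1.
by rewrite /f !Defs.compA s0' comp1m -!Defs.compA (Defs.compA (sh0 X)) s's comp1m dd' compm1.
Qed.

Lemma gend0_dim (X : A) n : dim_eq (hom X X) n -> dim_eq (gend X 0) n.
Proof.
have [s [ss' s's]] := sh0_iso X.
apply: (@dim_eq_iso _ (hom X X) (gend X 0) (fun f => sh0 X \oc f)).
  by move=> a f g; case: (comp_bilin X X (sh 0 X)) => _ ->.
by exists (fun f => s \oc f) => f; rewrite Defs.compA (ss', s's) comp1m.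
Qed.

Lemma calabi_yau_hom_dim p (E F : A) : calabi_yau A p ->
  exists2 n, dim_eq (hom E F) n & dim_eq (hom F (sh p E)) n.
Proof.
move=> [eta [eta_bilin eta_repr eta_natl eta_natr]].
(* Both sides are the pairing of [idm F] with [shm p f \oc g]. *)
have eta_sym (f : hom E F) g : eta F (sh p E) g (shm p f) = eta E F f g.
  by rewrite -{1}[g]compm1 eta_natr -eta_natl comp1m.
have zero_lin (V : lmodType K) : forall a (u v : V), (0 : K) = a * 0 + 0.
  by move=> a _ _; rewrite mulr0 addr0.
have fl (phi : hom F (sh p E) -> K^o) : linear_map phi ->
    exists f, forall g, eta E F f g = phi g.
  by move=> /eta_repr [f [Hf _]]; exists f.
(* [eta_repr] represents functionals of the second argument only. The bijection [shm p] and
   [eta_sym] exchange the two arguments. *)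
have fr (psi : hom E F -> K^o) : linear_map psi ->
    exists g, forall f, eta E F f g = psi f.
  move=> psil; have [inv invK] := choice (@shm_surj p E F).
  have Kinv : cancel (@shm K A p E F) inv by move=> f; apply: (@shm_inj p).
  have [|g [Hg _]] := eta_repr F (sh p E) (fun k => psi (inv k)).
    move=> a u v; rewrite -[RHS]psil; congr psi; apply: (@shm_inj p).
    by rewrite shm_lin !invK.
  by exists g => f; rewrite -eta_sym Hg Kinv.
have nl f : (forall g, eta E F f g = 0) -> f = 0.
  move=> f0; have [f' [_ U]] := eta_repr E F (fun=> 0) (zero_lin _).
  rewrite -(U f) ?(U 0) // => g; exact: (bilin0l _ (eta_bilin E F)).
have nr g : (forall f, eta E F f g = 0) -> g = 0.
  move=> g0; have [g' [_ U]] := eta_repr F (sh p E) (fun=> 0) (zero_lin _).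
  rewrite -(U g) ?(U 0) // => k; first exact: (bilin0l _ (eta_bilin _ _)).
  by have [f <-] := shm_surj k; rewrite eta_sym.
have [n dn] := pairing_fin_dim (eta_bilin E F) fl fr.
by exists n => //; apply: (pairing_dim (eta_bilin E F) fr nr dn).
Qed.

End Shift.

(** * Dimensions of homological units *)

Section Units.
Local Notation hom := Defs.hom.
Local Open Scope classical_set_scope.
Variables (C : numClosedFieldType) (A : tricat C).

(* A ring isomorphism need not be linear: the scalars of S act on T through the
   images of the multiples of the unit of S. *)
Lemma gring_iso_dim (S T : galg C) k m n :
  gring_iso S T -> dim_eq (S k) m -> dim_eq (T k) n -> m = n.
Proof.
move=> [f [fD fM _ fB]]; apply: commuting_actions_dim (fD k) _ (fB k).
move=> a b u v fv; have h : 0 + k = k by rewrite add0r.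
have scaleE (x : S k) : a *: x = gmul h (a *: gone S) x.
  by rewrite (bilinZl _ _ _ (gmul_bilin S h)) gmul1l.
rewrite !scaleE !fM fv; exact: bilinZr (gmul_bilin T h).
Qed.

Lemma gone_eq0 (S : galg C) : gone S = 0 -> forall k (x : S k), x = 0.
Proof.
move=> S0 k x; have h : 0 + k = k by rewrite add0r.
by rewrite -(gmul1l h x) S0 (bilin0l _ (gmul_bilin S h)).
Qed.

Lemma unit_dim_le (r : rank_function A) (T : galg C) (F : A) k n :
  unit_property r T -> r F != 0 -> dim_eq (gend F k) n ->
  exists2 m, (m <= n)%N & dim_eq (T k) m.
Proof.
move=> [i [t [imor _ tl ti]]] rF; have [il _ _] := imor F.
apply: dim_le (il k) _ => a b iab.
have := ti F k a; rewrite iab ti => /eqP; rewrite -subr_eq0 -scalerBr scaler_eq0.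
by rewrite intr_eq0 (negbTE rF) subr_eq0 => /eqP.
Qed.

Lemma fglift_linear (G : choiceType) (M : lmodType C) (phi : G -> M) :
  linear_map (fglift phi : {freeg G / C} -> M).
Proof.
have lB : {morph (fglift phi : {freeg G / C} -> M) : x y / x - y}.
  exact: lift_is_additive.
have l0 : fglift phi 0 = 0 by have := lB 0 0; rewrite !subrr.
have lD : {morph (fglift phi : {freeg G / C} -> M) : x y / x + y}.
  move=> x y; rewrite -{1}[y]opprK lB -[- y]sub0r lB l0 sub0r.
  by rewrite opprK.
have lS (I : seq G) (c : G -> C) :
    fglift phi (\sum_(x <- I) << c x *g x >>) = \sum_(x <- I) c x *: phi x.
  by rewrite (big_morph _ lD l0); apply: eq_bigr => x _; rewrite liftU.
move=> a x y; rewrite lD; congr (_ + _).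
rewrite -[in RHS](freeg_sumE x) [LHS]lS [X in _ = _ *: X]lS scaler_sumr.
by apply: eq_bigr => z _; rewrite scalerA.
Qed.

(** If the rank vanished on [U], the linear functional that it induces on [KnumK] would kill a
    generating set, hence every class, against nontriviality. *)
Lemma rank_generators (r : rank_function A) (U : set A) :
  nontrivial_rank r -> numerical_rank r -> cl_generates U ->
  exists2 F, U F & r F != 0.
Proof.
move=> [F0 rF0] [rho rhoE] gen; apply: contrapT => /forall2NP rU.
pose phi (x : Knum A) : C^o := (rho x)%:~R.
have llin : linear_map (fglift phi) by exact: fglift_linear.
have lB x y : fglift phi (x - y) = fglift phi x - fglift phi y.
  by rewrite (linD llin) (linN llin).
have l0 : fglift phi 0 = 0 by have := lB 0 0; rewrite !subrr.
have lU x : fglift phi << x >> = phi x by rewrite liftU scale1r.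
have phiU F : U F -> phi (cl F) = 0.
  by move=> UF; rewrite /phi -rhoE; have [//|/negP] := rU F; rewrite negbK => /eqP ->.
(* The functional stays on the free module: the class of [F0] gets a representative [y] that it
   kills, and it also kills the relations. *)
have [y yE y0] : exists2 y, tens1 (cl F0) = lquot_pi _ y & fglift phi y = 0.
  elim: (gen (tens1 (cl F0))) => [|a _ v [F UF <-] _ [y -> y0]].
    by exists 0 => //; rewrite /lquot_pi raddf0.
  exists (a *: << cl F >> + y); last by rewrite llin lU phiU // y0 scaler0 addr0.
  by rewrite lquot_piD lquot_piZ.
move: yE => /lquot_piP rel; have : fglift phi (<< cl F0 >> - y) = 0.
  elim: rel => [//|a _ v [x [z ->]] _ IH].
  rewrite llin IH addr0 !lB !lU /phi (raddfD rho) intrD.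
  by rewrite -addrA -opprD subrr scaler0.
rewrite lB lU y0 subr0 /phi -rhoE => /eqP; rewrite intr_eq0; exact/negP.
Qed.

Lemma gend_dim (F : A) k : calabi_yau A 3 -> exists n, dim_eq (gend F k) n.
Proof. by move=> /calabi_yau_hom_dim - /(_ F (sh k F))[n dn _]; exists n. Qed.

Lemma unit_fin_dim (r : rank_function A) (T : galg C) k :
  calabi_yau A 3 -> nontrivial_rank r -> unit_property r T ->
  exists n, dim_eq (T k) n.
Proof.
move=> cy [F rF] uT; have [n dn] := gend_dim F k cy.
by have [m _ dm] := unit_dim_le uT rF dn; exists m.
Qed.

(** One object [F] serves all degrees. The dimension of [gend F k] is recorded too, since it later
    shows that the unit of [gend F] is nonzero. *)
Lemma unit_dim_le_unitary (r : rank_function A) (T T' : galg C) :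
  calabi_yau A 3 -> nontrivial_rank r -> numerical_rank r -> unit_property r T ->
  cl_generates (unitary A T') ->
  exists F : A, forall k n, dim_eq (T' k) n ->
    dim_eq (gend F k) n /\ exists2 m, (m <= n)%N & dim_eq (T k) m.
Proof.
move=> cy nt num uT gen; have [F UF rF] := rank_generators nt num gen.
exists F => k n dT'; have [l dF] := gend_dim F k cy.
have e := gring_iso_dim UF dF dT'; rewrite e in dF; split=> //.
exact: unit_dim_le uT rF dF.
Qed.

Lemma eq_hodge (B : dga C) (T T' : galg C) :
  (forall k, ldim (T k) = ldim (T' k)) -> forall p q, hodge B T p q = hodge B T' p q.
Proof. by move=> TT' p q; rewrite /hodge !TT'. Qed.

Lemma ldim_unit_eq (r1 r2 : rank_function A) (T1 T2 : galg C) :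
  calabi_yau A 3 ->
  nontrivial_rank r1 -> numerical_rank r1 -> unit_property r1 T1 ->
  nontrivial_rank r2 -> numerical_rank r2 -> unit_property r2 T2 ->
  cl_generates (unitary A T1) -> cl_generates (unitary A T2) ->
  forall k, ldim (T1 k) = ldim (T2 k).
Proof.
move=> cy nt1 num1 u1 nt2 num2 u2 g1 g2 k.
have [n1 d1] := unit_fin_dim k cy nt1 u1; have [n2 d2] := unit_fin_dim k cy nt2 u2.
have [F1 /(_ _ _ d2)[_ [m1 le1 e1]]] := unit_dim_le_unitary cy nt1 num1 u1 g2.
have [F2 /(_ _ _ d1)[_ [m2 le2 e2]]] := unit_dim_le_unitary cy nt2 num2 u2 g1.
rewrite (ldimE d1) (ldimE d2); apply/eqP; rewrite eqn_leq.
by rewrite {1}(dim_eq_uniq d1 e1) {2}(dim_eq_uniq d2 e2) le1 le2.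
Qed.

Lemma C_plus_C3_dim (T : galg C) k :
  is_C_plus_C3 T -> dim_eq (T k) ((k == 0) || (k == 3)).
Proof.
move=> [T0 T3 Tk]; have [->|k0] := eqVneq k 0.
  rewrite -[nat_of_bool _]/1%N; exists (fun=> gone T); split=> // z _; have [c [zc cU]] := T0 z.
  exists (const_mx c); split=> [|d]; rewrite /= big_ord1; first by rewrite mxE -zc subrr.
  move=> /eqP; rewrite subr_eq0 => /eqP /cU dc.
  by apply/rowP => i; rewrite ord1 mxE dc.
have [->|k3] := eqVneq k 3; last by apply: eq0_dim; apply: Tk.
by have := @ldim_neq0 _ (T 3); rewrite T3; apply.
Qed.

Lemma ldim_unit_C_plus_C3 (r : rank_function A) (T1 T2 : galg C) (G : A) :
  calabi_yau A 3 -> nontrivial_rank r -> numerical_rank r -> unit_property r T2 ->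
  is_C_plus_C3 T1 -> cl_generates (unitary A T1) -> unitary A T2 G ->
  forall k, ldim (T1 k) = ldim (T2 k).
Proof.
move=> cy nt num u2 CC gen UG.
have [F dims] := unit_dim_le_unitary cy nt num u2 gen.
(* The dimension is at most 1. If it were 0, the unit of [gend F], being the image of that of [T2],
   would be 0, although [gend F 0] has dimension 1. *)
have d0 : dim_eq (T2 0) 1.
  have [dF [m le d]] := dims 0 _ (C_plus_C3_dim 0 CC).
  case: m le d => [|[|//]] _ // d.
  have gone0 : gone (gend F) = 0.
    have [i [_ [/(_ F)[il _ i1] _ _ _]]] := u2.
    by rewrite -i1 (dim_eq0 d (gone T2)); exact: lin0 (il 0).
  by have := dim_eq_uniq dF (eq0_dim (@gone_eq0 _ gone0 0)).
(* Serre duality equates the dimensions of [gend G] in degrees 0 and 3, and unitarity of [G]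
   transfers this to [T2]. *)
have d3 : dim_eq (T2 3) 1.
  have [n /(@gend0_dim _ A) dG0 dG3] := calabi_yau_hom_dim G G cy.
  have n1 := gring_iso_dim UG dG0 d0; rewrite n1 in dG3.
  have [m d] := unit_fin_dim 3 cy nt u2.
  have m1 := gring_iso_dim UG dG3 d; by rewrite -m1 in d.
move=> k; have dk := C_plus_C3_dim k CC; rewrite (ldimE dk).
have [_ [m le d]] := dims k _ dk; rewrite (ldimE d).
have [k0|k0] := eqVneq k 0; first by subst k; rewrite (dim_eq_uniq d d0).
have [k3|k3] := eqVneq k 3; first by subst k; rewrite (dim_eq_uniq d d3).
by move: le; rewrite (negbTE k0) (negbTE k3) leqn0 => /eqP ->.
Qed.

End Units.

Theorem theorem1p0p2 (R : realType) (A : tricat R[i]) (B : dga R[i])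
    (smooth_B : smooth_dga B) (proper_B : proper_dga B) (real_AB : realization A B)
    (cy_A : calabi_yau A 3)
    (rank1 rank2 : rank_function A)
    (nontriv1 : nontrivial_rank rank1) (nontriv2 : nontrivial_rank rank2)
    (num1 : numerical_rank rank1) (num2 : numerical_rank rank2)
    (T1 T2 : galg R[i])
    (unit1 : homological_unit rank1 T1) (unit2 : homological_unit rank2 T2) :
  (cl_generates (unitary A T1) -> cl_generates (unitary A T2) ->
   forall p q : 'I_4, hodge B T1 p q = hodge B T2 p q) /\
  (is_C_plus_C3 T1 -> cl_generates (unitary A T1) ->
   (exists F : A, unitary A T2 F) ->
   forall p q : 'I_4, hodge B T1 p q = hodge B T2 p q).
Proof.
have [u1 _] := unit1; have [u2 _] := unit2; split=> [g1 g2|CC g1 [G UG]] p q.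
  apply: eq_hodge.
  exact: (@ldim_unit_eq R[i] A rank1 rank2).
apply: eq_hodge.
exact: (@ldim_unit_C_plus_C3 R[i] A rank2 T1 T2 G).
Qed.
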